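(* Let $n\ge 1$, let $\alpha=(\alpha_1,\dots,\alpha_m)$ be a weak composition of $n$, and let $\delta$ be any weak composition. Let $\mathcal{W}_{\alpha,\delta}$ be the set of words with content $\alpha$ and cyclic descent type $\delta$, and let $\mathcal{W}_{\alpha,\delta}^{\mathrm{maj}}(q)=\sum_{w\in\mathcal{W}_{\alpha,\delta}}q^{\mathrm{maj}(w)}$. Then the triple $(\mathcal{W}_{\alpha,\delta},C_n,\mathcal{W}_{\alpha,\delta}^{\mathrm{maj}}(q))$ exhibits the cyclic sieving phenomenon, where $C_n$ acts by rotation. In particular it is a refinement of the CSP triple $(\mathcal{W}_\alpha,C_n,\mathcal{W}_\alpha^{\mathrm{maj}}(q))$, where $\mathcal{W}_\alpha$ is the set of words of content $\alpha$.
   Context: A word of length $n$ is a sequence $w=w_1\cdots w_n$ of positive integers. The content $\mathrm{cont}(w)$ is the sequence whose $j$-th entry is the number of occurrences of $j$ in $w$; for a weak composition $\alpha=(\alpha_1,\dots,\alpha_m)$ of $n$, $\mathcal{W}_\alpha$ is the set of words of content $\alpha$ (i.e. $\alpha_j$ copies of $j$ for each $j$, no other letters). The major index is $\mathrm{maj}(w)=\sum_{1\le i<n,\ w_i>w_{i+1}} i$. The number of cyclic descents is $\mathrm{cdes}(w)=\#\{1\le i\le n: w_i>w_{i+1}\}$ with indices taken mod $n$ (so $w_{n+1}=w_1$); the empty word has $\mathrm{cdes}=0$. For $i\ge 0$, $w^{(i)}$ denotes the subsequence of $w$ consisting of letters $\le i$. For $w\in\mathcal{W}_\alpha$ with $\alpha$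 having $m$ parts, the cyclic descent type is $\mathrm{CDT}(w)=(\mathrm{cdes}(w^{(1)}),\mathrm{cdes}(w^{(2)})-\mathrm{cdes}(w^{(1)}),\dots,\mathrm{cdes}(w^{(m)})-\mathrm{cdes}(w^{(m-1)}))$, and $\mathcal{W}_{\alpha,\delta}=\{w\in\mathcal{W}_\alpha:\mathrm{CDT}(w)=\delta\}$. The cyclic group $C_n=\langle\sigma_n\rangle$ of order $n$ acts on words of length $n$ by rotation $\sigma_n\cdot w_1\cdots w_{n-1}w_n=w_nw_1\cdots w_{n-1}$. For a finite set $W$ with an action of $C_n=\langle\sigma_n\rangle$ and $f(q)\in\mathbb{N}[q]$, the triple $(W,C_n,f(q))$ exhibits the cyclic sieving phenomenon (CSP) if for all $k\in\mathbb{Z}$, $\#\{w\in W:\sigma_n^k\cdot w=w\}=f(\omega_n^k)$ where $\omega_n$ is a fixed primitive $n$-th root of unity. A refinement of a CSP triple $(W,C_n,W^{\mathrm{stat}}(q))$ is a CSP triple $(V,C_n,V^{\mathrm{stat}}(q))$ with $V\subseteq W$ carrying the restricted action, where $V^{\mathrm{stat}}(q)=\sum_{v\in V}q^{\mathrm{stat}(v)}$. *)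

(* Defs.v *)
From HB Require Import structures.
From mathcomp Require Import all_boot all_order all_algebra all_fingroup.

Set Implicit Arguments.
Unset Strict Implicit.
Unset Printing Implicit Defensive.

Import GRing.Theory Num.Theory.

(* Words are sequences of natural numbers, all of whose letters are positive. *)

Definition is_word (w : seq nat) : bool := all (fun x => 0 < x) w.

(* The first m entries of cont(w). *)
Definition content (m : nat) (w : seq nat) : seq nat :=
  [seq count_mem j w | j <- iota 1 m].

(* nth is 0-based: w_i is nth 0 w i.-1 for 1 <= i <= size w. *)
Definition maj (w : seq nat) : nat :=
  \sum_(1 <= i < size w | nth 0 w i < nth 0 w i.-1) i.

Definition cdes (w : seq nat) : nat :=
  \sum_(i < size w) (nth 0 w (i.+1 %% size w) < nth 0 w i).

Definition subword_le (i : nat) (w : seq nat) : seq nat := [seq x <- w | x <= i].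

(* The entries are differences in int, so nothing is truncated.  For a word,
   subword_le 0 w is empty, so the first entry is cdes (subword_le 1 w). *)
Definition CDT (m : nat) (w : seq nat) : seq int :=
  [seq ((cdes (subword_le i w))%:Z - (cdes (subword_le i.-1 w))%:Z)%R
     | i <- iota 1 m].

(* Words of length n with letters <= m are carried by the finite type below;
   the letter 0 is excluded by is_word. *)
Notation wordType n m := (n.-tuple 'I_m.+1).

Definition word_of n m (w : wordType n m) : seq nat := map val w.

Definition words_cont n (alpha : seq nat) : {set wordType n (size alpha)} :=
  [set w | is_word (word_of w) & content (size alpha) (word_of w) == alpha].

Definition words_cont_cdt n (alpha delta : seq nat) :
    {set wordType n (size alpha)} :=
  [set w in words_cont n alpha
     | CDT (size alpha) (word_of w) == [seq d%:Z%R | d <- delta]].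

Definition word_maj n m (w : wordType n m) : nat := maj (word_of w).

(* For n > 0, the cyclic group of order n is the additive group of integers
   modulo n, carried by 'I_n (written 'I_n.-1.+1 so that the canonical group
   structure on 'I_p.+1 applies), with generator the class of 1. *)
Definition cyc (n : nat) : finGroupType := 'I_n.-1.+1.

Definition cyc_gen (n : nat) : cyc n := inZp 1.

(* rotr 1 sends w_1 ... w_n to w_n w_1 ... w_(n-1). *)
Definition rotate n (T : Type) (w : n.-tuple T) : n.-tuple T :=
  [tuple of rotr 1 w].

(* The class of i acts by sigma^i; rot_act_gen below checks that the generator
   acts by sigma. *)
Definition rot_fun n (T : Type) (w : n.-tuple T) (i : cyc n) : n.-tuple T :=
  iter (i : 'I_n.-1.+1) (@rotate n T) w.

Lemma rotr1_iter (T : Type) k (s : seq T) :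
  k <= size s -> iter k (rotr 1) s = rotr k s.
Proof.
elim: k => [|k IHk] le_ks; first by rewrite /= /rotr subn0 rot_size.
rewrite iterS IHk ?(ltnW le_ks) //; apply: (@rot_inj k.+1).
by rewrite rotrK rotS ?size_rotr // rot_rot !rotrK.
Qed.

Lemma val_rotate_iter n (T : Type) k (w : n.-tuple T) :
  iter k (@rotate n T) w = iter k (rotr 1) w :> seq T.
Proof. by elim: k => //= k ->. Qed.

Lemma rotate_period n (T : Type) (w : n.-tuple T) : iter n (@rotate n T) w = w.
Proof.
apply: val_inj; rewrite /= val_rotate_iter rotr1_iter ?size_tuple //.
by rewrite /rotr size_tuple subnn rot0.
Qed.

Lemma rotate_mod n (T : Type) k (w : n.-tuple T) :
  iter (k %% n.-1.+1) (@rotate n T) w = iter k (@rotate n T) w.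
Proof.
have per : iter n.-1.+1 (@rotate n T) w = w.
  case: n w => [|n] w /=; last exact: (rotate_period w).
  by rewrite [LHS]tuple0 [RHS]tuple0.
rewrite [in RHS](divn_eq k n.-1.+1) addnC iterD; congr (iter _ _ _).
by elim: (k %/ _) => [//|q IHq]; rewrite mulSn iterD -IHq per.
Qed.

Lemma rot_fun_is_action n (T : Type) : is_action [set: cyc n] (@rot_fun n T).
Proof.
split=> [i v w eq_vw | w i j _ _].
  have le_in : iter (n.-1.+1 - (i : 'I_n.-1.+1) + (i : 'I_n.-1.+1))
      (@rotate n T) v = iter (n.-1.+1 - (i : 'I_n.-1.+1) + (i : 'I_n.-1.+1))
      (@rotate n T) w by rewrite !iterD; congr (iter _ _ _).
  move: le_in; rewrite subnK ?(ltnW (ltn_ord _)) //.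
  by rewrite -(rotate_mod _ v) -(rotate_mod _ w) modnn.
by rewrite /rot_fun /= rotate_mod addnC iterD.
Qed.

Definition rot_act n (T : Type) : {action cyc n &-> n.-tuple T} :=
  Action (@rot_fun_is_action n T).

Lemma rot_act_gen n (T : Type) (w : n.-tuple T) :
  rot_act n T w (cyc_gen n) = rotate w.
Proof. exact: (rotate_mod 1 w). Qed.

Definition zexpg (gT : finGroupType) (x : gT) (k : int) : gT :=
  match k with Posz i => (x ^+ i)%g | Negz i => (x ^- i.+1)%g end.

Definition genfun (T : finType) (stat : T -> nat) (W : {set T}) : {poly nat} :=
  (\sum_(w in W) 'X^(stat w))%R.

Definition poly_nat_eval (C : nzSemiRingType) (f : {poly nat}) (z : C) : C :=
  (map_poly (fun c : nat => c%:R) f).[z]%R.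

(* C plays the role of the complex numbers; the cyclic group of order n is the
   whole group gT = <[sigma]>, and W is stable under its action. *)
Definition CSP (C : numClosedFieldType) (n : nat) (gT : finGroupType)
    (sigma : gT) (T : finType) (to : {action gT &-> T}) (W : {set T})
    (f : {poly nat}) : Prop :=
  [/\ [set: gT] = <[sigma]>%g, #[sigma]%g = n, [acts [set: gT], on W | to] &
      forall omega : C, (n.-primitive_root omega)%R ->
      forall k : int,
        (#|('Fix_(W | to)[zexpg sigma k])%g|%:R
           = poly_nat_eval f (omega ^ k))%R].

Definition CSP_refinement (C : numClosedFieldType) (n : nat)
    (gT : finGroupType) (sigma : gT) (T : finType) (to : {action gT &-> T})
    (stat : T -> nat) (W V : {set T}) : Prop :=
  [/\ CSP C n sigma to W (genfun stat W),
      CSP C n sigma to V (genfun stat V) & V \subset W].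

(* Main.v *)
Require Import Defs.
From mathcomp Require Import all_boot all_order all_algebra all_fingroup.
From mathcomp Require Import zify ring.

(* Rotating w changes maj by -cdes modulo n, so the sum of z^maj over the words
   of given content and cyclic descent type vanishes at a primitive d-th root
   of unity z (d | n) unless d divides cdes; if it does, z^maj is invariant
   under rotation and double counting the occurrences of the least letter
   reduces the claim to words that begin with their least letter.  Such words
   arise by successively inserting the letters M = 1, 2, ....  Inserting a
   copies of M into a word v of length l with k cyclic descents, so that s
   cyclic descents are added, multiplies z^maj(v) by a factor that depends only
   on l, k, a, s:
     z^(k s + s(s+1)/2) e_s(z, ..., z^(l-k)) h_(a-s)(z, ..., z^(k+s)).
   At a primitive d-th root of unity, e_s and h_e in a multiple of d variables
   vanish unless d divides their degree, and then they are, up to a sign that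
   z^(s(s+1)/2) absorbs, their values at z = 1 with all arguments divided by d.
   So the sum equals the number of words u for alpha/d and delta/d, and their
   powers u^d are exactly the words fixed by rotation by n/d. *)

Set Implicit Arguments.
Unset Strict Implicit.
Unset Printing Implicit Defensive.

Import GRing.Theory Num.Theory.

(** * Symmetric functions of the powers of a root of unity *)

Section SymmetricFunctionsOfPowers.
Local Open Scope ring_scope.

Variable F : fieldType.
Implicit Types (z c : F) (N M s e p k d : nat).

(* [e_s (z, z^2, ..., z^N)]. *)
Definition epow z N s : F := (\prod_(i < N) (1 + z ^+ i.+1 *: 'X))`_s.

(* [h_e (z, z^2, ..., z^p)], by the recursion on the last variable. *)
Fixpoint hpow z p : nat -> F :=
  if p is p'.+1 then
    fix hpow_p e := if e is e'.+1 then hpow z p' e + z ^+ p * hpow_p e' else 1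
  else fun e => (e == 0)%:R.

Lemma hpow0 z p : hpow z p 0 = 1.
Proof. by case: p. Qed.

Lemma hpowS z p e :
  hpow z p.+1 e.+1 = hpow z p e.+1 + z ^+ p.+1 * hpow z p.+1 e.
Proof. by []. Qed.

Lemma coef_prod_scale z c N s :
  (\prod_(i < N) (1 + (z ^+ i.+1 * c) *: 'X))`_s = c ^+ s * epow z N s.
Proof.
rewrite /epow; elim: N s => [|N IHN] s.
  by rewrite !big_ord0 coef1; case: s => [|s]; rewrite ?mulr1 ?mulr0.
rewrite !big_ord_recr /= !mulrDr !mulr1 !coefD IHN mulrDr; congr (_ + _).
rewrite -!scalerAr !coefZ !coefMX; case: s => [|s] /=; first by rewrite !mulr0.
by rewrite IHN [c ^+ s.+1]exprS; ring.
Qed.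

Lemma epow0 z N : epow z N 0 = 1.
Proof.
rewrite /epow; elim: N => [|N IHN]; first by rewrite big_ord0 coef1.
by rewrite big_ord_recr /= mulrDr mulr1 coefD IHN -scalerAr coefZ coefMX mulr0
  addr0.
Qed.

Lemma epow0S z s : epow z 0 s.+1 = 0.
Proof. by rewrite /epow big_ord0 coef1. Qed.

(** Splitting off the first variable [z] leaves the powers from [z ^+ 2] on, which are [z] times the
    first [N] powers; [coef_prod_scale] applies with [c = z]. *)
Lemma epowS z N s : epow z N.+1 s.+1 = z ^+ s.+1 * (epow z N s.+1 + epow z N s).
Proof.
rewrite {1}/epow big_ord_recl mulrDl mul1r coefD -scalerAl coefZ coefXM /=.
under eq_bigr => i _ do rewrite /bump leq0n add1n exprSr.
by rewrite !coef_prod_scale expr1 mulrA -exprS -mulrDr.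
Qed.

(** * Periodicity at a primitive root of unity *)

Section RootOfUnity.

Variables (z : F) (d : nat).
Hypothesis prim_z : d.-primitive_root z.

Let d_gt0 : (0 < d)%N := prim_order_gt0 prim_z.

Let z_neq0 : z != 0.
Proof.
apply: contraTneq (oner_neq0 F) => z0.
by rewrite -(prim_expr_order prim_z) z0 expr0n (gtn_eqF d_gt0) eqxx.
Qed.

Lemma prim_root_inv : d.-primitive_root z^-1.
Proof.
have -> : z^-1 = z ^+ d.-1.
  by apply: (mulfI z_neq0); rewrite divff
    ?z_neq0 // -exprS prednK // prim_expr_order.
by rewrite prim_root_exp_coprime //; case: (d) d_gt0 => // d' _;
  apply: coprimenS.
Qed.

(* Factor out each [- z^i] and use [X^d - 1 = \prod_i (X - z^-i)]. *)
Lemma prod_1_sub_prim_root :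
  \prod_(i < d) (1 - z ^+ i *: 'X) = 1 - 'X^d :> {poly F}.
Proof.
have E : \prod_(i < d) (1 - z ^+ i *: 'X)
    = (\prod_(i < d) (- z ^+ i)) *: ('X^d - 1) :> {poly F}.
  rewrite -(factor_Xn_sub_1 prim_root_inv) big_mkord -scaler_prod.
  apply: eq_bigr => i _.
  rewrite scaleNr scalerBr opprB -[_ *: _%:P]mul_polyC -polyCM exprVn.
  by rewrite divff ?expf_neq0.
(* Evaluation at 0 shows that the constant in [E] is -1. *)
have := congr1 (fun f : {poly F} => f.[0]) E.
rewrite horner_prod hornerZ !hornerE expr0n (gtn_eqF d_gt0) /= sub0r.
rewrite big1 => [|i _]; last by rewrite !hornerE subr0.
move=> c1; rewrite E -[X in X *: _]opprK -[- \prod_(_ < _) _]mulrN1 -c1.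
by rewrite scaleN1r opprB.
Qed.

(** Passing from [k] to [k.+1] drops the factor with exponent [k] and adds the one with exponent
    [k + d], which is the same. *)
Lemma prod_1_sub_prim_root_shift k :
  \prod_(i < d) (1 - z ^+ (k + i) *: 'X) = 1 - 'X^d :> {poly F}.
Proof.
elim: k => [|k IHk]; first exact: prod_1_sub_prim_root.
rewrite -[RHS]IHk; case: (d) prim_z d_gt0 => // d' prim _.
rewrite big_ord_recr [RHS]big_ord_recl /= mulrC addn0; congr (_ * _).
  by rewrite addSnnS exprD (prim_expr_order prim) mulr1.
by apply: eq_bigr => i _; rewrite /bump leq0n addSnnS.
Qed.

Lemma prod_1_add_prim_root k :
  \prod_(i < d) (1 + z ^+ (k + i) *: 'X) = 1 + (- (-1) ^+ d) *: 'X^d :> {poly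
    F}.
Proof.
have /(congr1 (fun q => q \Po (- 'X))) := prod_1_sub_prim_root_shift k.
rewrite rmorph_prod /= comp_polyB comp_Xn_poly comp_polyC polyC1 => H.
transitivity (1 - (- 'X) ^+ d : {poly F}).
  rewrite -H; apply: eq_bigr => i _.
  by rewrite comp_polyB comp_polyZ comp_polyX comp_polyC polyC1 scalerN opprK.
by rewrite [(- 'X) ^+ d]exprNn scaleNr -mul_polyC polyC_exp polyCN polyC1.
Qed.

(** The [d * M] factors form [M] blocks of [d] consecutive powers. By [prod_1_add_prim_root] each
    block is [1 + c *: 'X^d] with [c = - (-1) ^+ d], so only degrees divisible by [d] occur. *)
Lemma epow_prim_root M s :
  epow z (d * M)%N s =
    if (d %| s)%N then (- (-1) ^+ d) ^+ (s %/ d)%N * epow 1 M (s %/ d)%N else 0.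
Proof.
rewrite {1}/epow.
have ->: \prod_(i < d * M) (1 + z ^+ i.+1 *: 'X)
    = (\prod_(i < M) (1 + (1 ^+ i.+1 * - (-1) ^+ d) *: 'X)) \Po 'X^d.
  rewrite rmorph_prod /=; elim: M => [|M IHM]; first by rewrite muln0 !big_ord0.
  rewrite mulnS addnC big_split_ord [RHS]big_ord_recr /= IHM; congr (_ * _).
  rewrite comp_polyD comp_polyZ comp_polyX comp_polyC polyC1 expr1n mul1r.
  rewrite -(prod_1_add_prim_root 1); apply: eq_bigr => i _.
  by rewrite add1n -addnS exprD exprM (prim_expr_order prim_z) expr1n mul1r.
by rewrite coef_comp_poly_Xn // coef_prod_scale.
Qed.

(** This cancels the sign in [epow_prim_root]. For [s = 1] the power of [z] is the sign itself; in
    general ['C((d * s).+1, 2)] is congruent to [s * 'C(d.+1, 2)] modulo [d]. *)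
Lemma expr_bin2_prim_root s :
  z ^+ 'C((d * s).+1, 2) * (- (-1) ^+ d) ^+ s = 1.
Proof.
have zd : z ^+ 'C(d.+1, 2) = - (-1) ^+ d.
  (* Comparison of the coefficients of ['X^d]: the factors have degree at most 1, so the product has
     the coefficient on the left. *)
  have Hi : \prod_(i < d) - z ^+ i = -1.
    have := congr1 (fun f : {poly F} => f`_d) prod_1_sub_prim_root.
    rewrite /= coefB coef1 coefXn eqxx (gtn_eqF d_gt0) sub0r => <-.
    elim: (d) => [|m IHm]; first by rewrite !big_ord0 coef1.
    rewrite !big_ord_recr /= IHm mulrBr mulr1 -scalerAr coefB coefZ coefMX /=.
    rewrite [X in X - _]nth_default ?sub0r ?mulrN 1?mulrC //.
    elim: (m) => [|j IHj]; first by rewrite big_ord0 size_poly1.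
    rewrite big_ord_recr /= (leq_trans (size_polyMleq _ _)) //.
    have size2 : (size (1 - z ^+ j *: 'X : {poly F})%R <= 2)%N.
      rewrite (leq_trans (size_polyD _ _)) // geq_max size_poly1 size_polyN.
      by rewrite (leq_trans (size_scale_leq _ _)) // size_polyX.
    rewrite -subn1 leq_subLR add1n; apply: leq_trans (leq_add IHj size2) _.
    by rewrite addn2.
  have -> : 'C(d.+1, 2) = (d + \sum_(i < d) i)%N.
    by rewrite -bin2_sum big_mkord big_ord_recr /= addnC.
  rewrite exprD (prim_expr_order prim_z) mul1r -prodrXr.
  move: Hi; rewrite prodrN card_ord => Hi.
  by rewrite -mulrN1 -[X in _ = _ * X]Hi mulrA -exprMn mulrNN mulr1 expr1n
    mul1r.
elim: s => [|s IHs]; first by rewrite muln0 expr0 mulr1.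
have -> : 'C((d * s.+1).+1, 2) = ('C((d * s).+1, 2) + 'C(d.+1, 2) + d * (d *
  s))%N.
  rewrite mulnS; elim: (d) {IHs zd} (d * s)%N => [|m IHm] j.
    by rewrite mul0n !addn0.
  by rewrite addSn binS bin1 IHm ['C(m.+2, 2)]binS bin1 mulSn; lia.
rewrite 2!exprD [z ^+ (d * _)]exprM (prim_expr_order prim_z) expr1n mulr1 zd.
by rewrite exprSr mulrACA IHs mul1r mulrNN -expr2 sqrr_sign.
Qed.

(* The polynomial [f] in the shift operator [u |-> (e |-> u (e - 1))], applied
   to the sequence [u] extended by 0 to negative indices. *)
Definition shift_act (f : {poly F}) (u : nat -> F) e : F :=
  \sum_(j < e.+1) f`_j * u (e - j)%N.

Lemma shift_act1 u e : shift_act 1 u e = u e.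
Proof.
rewrite /shift_act big_ord_recl coef1 mul1r subn0 big1 ?addr0 // => i _.
by rewrite coef1 mul0r.
Qed.

Lemma shift_actX c f u e :
  shift_act (f * (1 - c *: 'X)) u e
    = shift_act f (fun i => u i - (if i is i'.+1 then c * u i' else 0)) e.
Proof.
rewrite /shift_act.
under eq_bigr => j _ do
  rewrite mulrBr mulr1 -scalerAr coefB coefZ coefMX mulrBl.
under [RHS]eq_bigr => j _ do rewrite mulrBr.
rewrite !sumrB; congr (_ - _).
rewrite big_ord_recl /= mulr0 mul0r add0r [RHS]big_ord_recr /= subnn mulr0
  addr0.
apply: eq_bigr => i _; rewrite /bump leq0n add1n /=.
have -> : (e - i = (e - i.+1).+1)%N by have := ltn_ord i; lia.
by rewrite mulrCA mulrA.
Qed.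

(** By [hpowS], the factor [1 - z ^+ p.+1 *: 'X] undoes the adjunction of the variable
    [z ^+ p.+1]. *)
Lemma hpow_shift k p e :
  shift_act (\prod_(i < k) (1 - z ^+ (p.+1 + i) *: 'X)) (hpow z (p + k)) e
    = hpow z p e.
Proof.
elim: k => [|k IHk]; first by rewrite big_ord0 shift_act1 addn0.
rewrite big_ord_recr /= shift_actX -[RHS]IHk; apply: eq_bigr => j _.
congr (_ * _); case: (e - j)%N => [|e']; first by rewrite subr0 !hpow0.
by rewrite addnS hpowS addSn addrK.
Qed.

(** The factors that remove [d] consecutive variables multiply to [1 - 'X^d]. *)
Lemma hpow_period p e :
  hpow z (p + d) e
    = hpow z p e + (if (d <= e)%N then hpow z (p + d) (e - d) else 0).
Proof.
have := hpow_shift d p e; rewrite prod_1_sub_prim_root_shift => <-.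
rewrite /shift_act; under eq_bigr => j _ do rewrite coefB mulrBl.
rewrite sumrB -/(shift_act 1 _ _) shift_act1 -addrA -[LHS]addr0; congr (_ + _).
apply/esym/eqP; rewrite addrC subr_eq0; apply/eqP.
case: leqP => [le_de|lt_ed]; last first.
  rewrite big1 // => j _; rewrite coefXn; case: eqP => [jd|];
    last by rewrite mul0r.
  by have := ltn_ord j; rewrite jd; lia.
rewrite (bigD1 (inord d)) //= inordK // coefXn eqxx mul1r big1 ?addr0 // => j.
by rewrite coefXn -val_eqE /= inordK // => /negbTE->; rewrite mul0r.
Qed.

End RootOfUnity.

(** Adjoining [d] variables by [hpow_period] is, with all degrees divided by [d], the recursion
    [hpowS] at 1. *)
Lemma hpow_prim_root z d P e : d.-primitive_root z ->
  hpow z (d * P) e = if (d %| e)%N then hpow 1 P (e %/ d) else 0.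
Proof.
move=> prim_z; have d_gt0 := prim_order_gt0 prim_z.
elim: P e => [|P IHP] e.
  rewrite muln0 /=; case: e => [|e]; first by rewrite dvdn0 div0n.
  case: ifP => // /dvdn_leq le_de.
  by rewrite -[(_ %/ _ == 0)%N]leqn0 [(_ %/ _ <= 0)%N]leqNgt divn_gt0 ?le_de.
(* Strong induction on the degree: the recursion refers to the degree [e - d] in the same
   variables. *)
rewrite mulnS addnC; have [m] := ubnP e; elim: m e => // m IHm e lt_em.
rewrite hpow_period // IHP; case: leqP => [le_de|lt_ed].
  rewrite IHm; last by lia.
  rewrite -(subnK le_de); set i := (e - d)%N; rewrite addnK dvdn_addl //.
  rewrite divnDr // divnn d_gt0 addn1.
  by case: ifP; rewrite ?addr0 // hpowS expr1n mul1r.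
rewrite addr0; case: e lt_ed {lt_em} => [|e] lt_ed;
  first by rewrite div0n !hpow0.
by rewrite gtnNdvd.
Qed.

End SymmetricFunctionsOfPowers.

(** * Cyclic descents and major index *)

(* Descents of the word [w] followed by the letter [t]; if [t] is the first
   letter of [w] these are the cyclic descents, and [rmaj] is the sum of their
   positions, where a descent at the end counts [size w] (0 in [maj]). *)
Fixpoint rdes (t : nat) (w : seq nat) : nat :=
  if w is x :: v then (head t v < x) + rdes t v else 0.

Fixpoint rmaj (t : nat) (w : seq nat) : nat :=
  if w is x :: v then rdes t w + rmaj t v else 0.

(** The default value [t] of [nth] serves as the letter after the last one. *)
Lemma rdesE t w :
  rdes t w = \sum_(i < size w) (nth t w i.+1 < nth t w i).
Proof.
elim: w => [|x w IHw]; first by rewrite big_ord0.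
by rewrite /= big_ord_recl IHw; case: w {IHw}.
Qed.

Lemma rmajE t w :
  rmaj t w = \sum_(i < size w) i.+1 * (nth t w i.+1 < nth t w i).
Proof.
elim: w => [|x w IHw]; first by rewrite big_ord0.
rewrite /= big_ord_recl IHw rdesE mul1n -addnA -big_split.
by congr (_ + _).
Qed.

Lemma cdesE w : cdes w = rdes (head 0 w) w.
Proof.
rewrite /cdes rdesE; apply: eq_bigr => i _.
rewrite [in RHS](set_nth_default 0 _ (ltn_ord i)); congr (_ < _ : nat).
have := ltn_ord i; rewrite leq_eqVlt => /orP[/eqP i_max|lt_i].
  by rewrite i_max modnn nth0 nth_default // i_max.
by rewrite modn_small //; apply: set_nth_default.
Qed.

Lemma rmaj_maj w : exists c, rmaj (head 0 w) w = maj w + c * size w.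
Proof.
case: w => [|x w]; first by exists 0; rewrite /maj big_geq.
(* The witness is 1 exactly if the last letter exceeds the first letter [x]. *)
exists (nth x (x :: w) (size w).+1 < nth x (x :: w) (size w)).
rewrite rmajE /= big_ord_recr /= mulnC; congr (_ + _).
rewrite /maj big_add1 big_mkord /= [RHS]big_mkcond /=.
apply: eq_bigr => i _.
rewrite !(set_nth_default x 0) /= ?ltnS ?(ltnW (ltn_ord i)) //.
by case: ifP => _; rewrite ?muln1 ?muln0.
Qed.

Lemma rdes_cat t u w : rdes t (u ++ w) = rdes (head t w) u + rdes t w.
Proof.
elim: u => [//|x u IHu] /=; rewrite IHu addnA; congr (_ + _ + _).
by case: u {IHu}.
Qed.

Lemma rmaj_rcons t v x :
  rmaj t (rcons v x) = rmaj x v + (size v).+1 * (t < x).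
Proof.
elim: v => [|y v IHv] /=; first by rewrite mul1n addn0 addn0.
rewrite IHv -cats1 rdes_cat /= addn0.
have -> : head t (v ++ [:: x]) = head x v by case: v {IHv}.
by rewrite [(size v).+2 * _]mulSn; lia.
Qed.

Lemma cdes_rot1 w : cdes (rot 1 w) = cdes w.
Proof.
case: w => [//|x v]; rewrite !cdesE rot1_cons -cats1 rdes_cat /= addn0.
by rewrite addnC; case: v.
Qed.

(** Rotation lowers the position of each cyclic descent by one; a descent at position 1 moves to
    position [size w] instead of 0, which accounts for [c]. *)
Lemma rmaj_rot1 w :
  exists c, rmaj (head 0 (rot 1 w)) (rot 1 w) + cdes w
    = rmaj (head 0 w) w + c * size w.
Proof.
case: w => [|x v]; first by exists 0; rewrite /cdes big_ord0.
exists (head 0 (rcons v x) < x); rewrite rot1_cons rmaj_rcons cdesE /=; lia.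
Qed.

Lemma cdes_rot i w : cdes (rot i w) = cdes w.
Proof.
elim: i => [|i IHi]; first by rewrite rot0.
have [lt_i|le_i] := ltnP i (size w); first by rewrite rotS // cdes_rot1.
by rewrite rot_oversize // ltnW.
Qed.

Lemma cdes_nseq a x : cdes (nseq a x) = 0.
Proof.
rewrite cdesE; suff H : rdes x (nseq a x) = 0 by case: a H.
by elim: a => [//|[|a] IHa]; rewrite /= ltnn // in IHa *.
Qed.

Lemma rmaj_nseq a x : rmaj x (nseq a x) = 0.
Proof.
elim: a => [//|a IHa]; rewrite [LHS]/= IHa addn0.
by have := cdes_nseq a.+1 x; rewrite cdesE.
Qed.

Lemma filter_rot1 (p : pred nat) w :
  filter p (rot 1 w) = filter p w \/ filter p (rot 1 w) = rot 1 (filter p w).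
Proof.
case: w => [|x v]; first by left.
rewrite rot1_cons filter_rcons /=; case: (p x); last by left.
by right; rewrite rot1_cons.
Qed.

Lemma cdes_filter_rot1 (p : pred nat) w :
  cdes (filter p (rot 1 w)) = cdes (filter p w).
Proof. by case: (filter_rot1 p w) => ->; rewrite ?cdes_rot1. Qed.

Lemma CDT_rot1 m w : CDT m (rot 1 w) = CDT m w.
Proof. by apply: eq_map => i; rewrite /subword_le !cdes_filter_rot1. Qed.

(* Deleting [y] between [x] and [z] cannot create a descent, because [x > z]
   forces [x > y] or [y > z]. *)
Lemma rdes_filter (p : pred nat) t h v :
  (head t (filter p v) < h) + rdes t (filter p v) <= (head t v < h) + rdes t v.
Proof.
elim: v h => [//|x v IHv] h /=; case: (p x) => /=; first by rewrite leq_add2l.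
apply: leq_trans (IHv h) _.
by rewrite addnA leq_add2r; do 3 case: ltnP => //; lia.
Qed.

Lemma cdes_filter (p : pred nat) w : cdes (filter p w) <= cdes w.
Proof.
have [pw|] := boolP (has p w); last by rewrite has_filter negbK cdesE => /eqP->.
(* After a rotation the word begins with a letter [x] that is kept; the cyclic descents before and
   after the deletion are then both descents relative to [t = x]. *)
case/split_find: pw => x v1 v2 px npv1.
rewrite -cats1 -catA -[X in _ <= X](cdes_rot (size v1)) rot_size_cat -catA.
rewrite !filter_cat /= px.
have -> : filter p v1 = [::] by apply/eqP; rewrite -[_ == _]negbK -has_filter.
rewrite cat0s !cdesE /=.
have := rdes_filter p x x (v2 ++ v1); rewrite filter_cat.
have -> : filter p v1 = [::] by apply/eqP; rewrite -[_ == _]negbK -has_filter.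
by rewrite cats0.
Qed.

(** * Insertion of the largest letter *)

Section Shuffles.

Variable M : nat.
Implicit Types (v z : seq nat) (b : nat).

Fixpoint shuffle_max (g : nat -> seq (seq nat)) b : seq (seq nat) :=
  if b is b'.+1 then [seq M :: z | z <- shuffle_max g b' ++ g b'] else [::].

(* The shuffles of [v] with [b] letters [M] that do not begin with [M];
   [shuffle_max (shuffle v) b] lists those that do. *)
Fixpoint shuffle v : nat -> seq (seq nat) :=
  if v is x :: v' then
    fun b => [seq x :: z | z <- shuffle v' b ++ shuffle_max (shuffle v') b]
  else fun b => nseq (b == 0) [::].

Lemma head_shuffle t v b z : z \in shuffle v b -> head t z = head t v.
Proof.
case: v => [|x v] /=; first by case: b => // /[!inE] /eqP->.
by case/mapP => y _ ->.
Qed.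

Lemma head_shuffle_max t g b z : z \in shuffle_max g b -> head t z = M.
Proof. by case: b => //= b /mapP[y _ ->]. Qed.

Section Descents.

Variable t : nat.
Hypothesis lt_tM : t < M.

Lemma head_lt v : all (fun x => x < M) v -> head t v < M.
Proof. by case: v => [//|x v] /andP[]. Qed.

Lemma rdes_cons_shuffle v b x z : z \in shuffle v b ->
  rdes t (x :: z) = (head t v < x) + rdes t z.
Proof. by move=> zv /=; rewrite (head_shuffle _ zv). Qed.

Lemma rdes_cons_shuffle_max g b x z : x <= M -> z \in shuffle_max g b ->
  rdes t (x :: z) = rdes t z.
Proof. by move=> le_xM zv /=; rewrite (head_shuffle_max _ zv) ltnNge le_xM. Qed.

(** An initial run of [M] ends with a new descent, as [t] and the letters of [v] are below [M]. The
    bounds on [shuffle v] are assumed because the lemma is used inside the induction that proves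
    them. *)
Lemma rdes_shuffle_max v b z : all (fun x => x < M) v ->
    (forall b' y, y \in shuffle v b' ->
       rdes t v <= rdes t y <= rdes t v + b') ->
  z \in shuffle_max (shuffle v) b -> rdes t v < rdes t z <= rdes t v + b.
Proof.
move=> ltvM bnd; elim: b z => [//|b IHb] z /mapP[y + ->].
rewrite mem_cat => /orP[y_max|y_v].
  by rewrite (rdes_cons_shuffle_max _ y_max) //; have := IHb y y_max; lia.
by rewrite (rdes_cons_shuffle _ y_v) (head_lt ltvM); have := bnd b y y_v; lia.
Qed.

Lemma rdes_shuffle v b z : all (fun x => x < M) v ->
  z \in shuffle v b -> rdes t v <= rdes t z <= rdes t v + b.
Proof.
elim: v b z => [|x v IHv] b z.
  by case: b => // _ /[!inE] /eqP->.
case/andP=> ltxM ltvM /mapP[y + ->]; rewrite mem_cat => /orP[y_v|y_max].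
  by rewrite (rdes_cons_shuffle _ y_v); have := IHv b y ltvM y_v; rewrite /=;
    lia.
rewrite (rdes_cons_shuffle_max (ltnW ltxM) y_max) /=.
have := rdes_shuffle_max ltvM (fun b' y' => IHv b' y' ltvM) y_max.
by case: (_ < x); lia.
Qed.

Lemma rdes_le_size v : rdes t v <= size v.
Proof. by elim: v => //= x v IHv; case: (_ < x); lia. Qed.

Local Open Scope ring_scope.

Variables (F : fieldType) (q : F).

(** For a word with [k] descents and [N] other positions, this is the factor due to the [s] new
    descents; the remaining letters [M] contribute [hpow]. *)
Definition shuffle_weight N k s : F := q ^+ (k * s + 'C(s.+1, 2)) * epow q N s.

Lemma shuffle_weight0 N k : shuffle_weight N k 0 = 1.
Proof. by rewrite /shuffle_weight muln0 epow0 mulr1. Qed.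

(** The recursion for a new first letter that forms no descent and so increases [N];
    [shuffle_weightSk] is the one for a descent, which increases [k]. *)
Lemma shuffle_weightS N k s :
  shuffle_weight N.+1 k s.+1
    = q ^+ s.+1 * (shuffle_weight N k s.+1
                   + q ^+ (k + s.+1) * shuffle_weight N k s).
Proof.
rewrite /shuffle_weight epowS ['C(s.+2, 2)]binS bin1 mulnS.
rewrite !exprD; ring.
Qed.

Lemma shuffle_weightSk N k s :
  shuffle_weight N k.+1 s = q ^+ s * shuffle_weight N k s.
Proof. by rewrite /shuffle_weight mulSn -addnA exprD mulrA. Qed.

(** A new first letter moves every old descent up one place and may itself be a descent at place 1,
    so [rmaj] grows by the number [K] of descents of the new word. *)
Lemma sum_cons_cat x (A B : seq (seq nat)) K :
  \sum_(z <- [seq x :: y | y <- A ++ B] | rdes t z == K) q ^+ rmaj t z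
    = q ^+ K * (\sum_(y <- A | rdes t (x :: y) == K) q ^+ rmaj t y
                + \sum_(y <- B | rdes t (x :: y) == K) q ^+ rmaj t y).
Proof.
rewrite -big_cat big_map mulr_sumr; apply: eq_bigr => y /eqP rK.
by rewrite -exprD -[in RHS]rK.
Qed.

Lemma eq_sum_in (A : seq (seq nat)) (P Q : pred (seq nat)) (f : seq nat -> F) :
  {in A, P =1 Q} -> \sum_(y <- A | P y) f y = \sum_(y <- A | Q y) f y.
Proof.
move=> PQ; rewrite big_seq_cond [RHS]big_seq_cond; apply: eq_bigl => y.
by apply: andb_id2l => /PQ.
Qed.

Lemma sum_in0 (A : seq (seq nat)) (P : pred (seq nat)) (f : seq nat -> F) :
  {in A, P =1 pred0} -> \sum_(y <- A | P y) f y = 0.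
Proof. by move=> P0; rewrite (eq_sum_in f P0) big_pred0. Qed.

(** What follows the first [M] begins with another [M] or does not; the two terms form the recursion
    [hpowS]. The formula for [shuffle v] is a hypothesis, to be supplied by the induction in
    [sum_shuffle]. *)
Lemma sum_shuffle_max v s e : all (fun x => x < M)%N v ->
    (forall s' e',
       \sum_(z <- shuffle v (s' + e') | rdes t z == (rdes t v + s')%N)
          q ^+ rmaj t z
       = q ^+ rmaj t v * shuffle_weight (size v - rdes t v) (rdes t v) s'
         * hpow q (rdes t v + s') e') ->
  \sum_(z <- shuffle_max (shuffle v) (s.+1 + e)
      | rdes t z == (rdes t v + s.+1)%N) q ^+ rmaj t z
  = q ^+ rmaj t v * shuffle_weight (size v - rdes t v) (rdes t v) s
    * q ^+ (rdes t v + s.+1) * hpow q (rdes t v + s.+1) e.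
Proof.
move=> ltvM IH.
have bnd b z := @rdes_shuffle_max v b z ltvM (fun b' y => @rdes_shuffle v b' y
  ltvM).
have step b : \sum_(y <- shuffle v b | rdes t (M :: y) == (rdes t v + s.+1)%N)
    q ^+ rmaj t y = \sum_(y <- shuffle v b | rdes t y == (rdes t v + s)%N) q ^+
      rmaj t y.
  apply: eq_sum_in => y yv.
  by rewrite (rdes_cons_shuffle _ yv) (head_lt ltvM) add1n addnS eqSS.
elim: e => [|e IHe]; rewrite addSn [shuffle_max _ _]/= sum_cons_cat step IH.
  (* For [e = 0], a remainder that begins with [M] has only [s] inserted letters, too few for [s.+1]
     new descents. *)
  rewrite sum_in0 ?hpow0; first by rewrite add0r; ring.
  move=> y y_max; rewrite (rdes_cons_shuffle_max _ y_max) //=.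
  by have := bnd _ _ y_max; case: eqP => //; lia.
rewrite (@eq_sum_in _ _ (fun y => rdes t y == rdes t v + s.+1)%N); last first.
  by move=> y y_max; rewrite (rdes_cons_shuffle_max _ y_max).
rewrite -[(s + e.+1)%N]addSnnS IHe !addnS hpowS; ring.
Qed.

(** Induction on [v]. If letters [M] follow the first letter [x], they take over its descent when
    [x] has one, which gives the recursion of [hpow], and otherwise create one, which gives that of
    [shuffle_weight]. *)
Lemma sum_shuffle v s e : all (fun x => x < M)%N v ->
  \sum_(z <- shuffle v (s + e) | rdes t z == (rdes t v + s)%N) q ^+ rmaj t z
  = q ^+ rmaj t v * shuffle_weight (size v - rdes t v) (rdes t v) s
    * hpow q (rdes t v + s) e.
Proof.
elim: v s e => [|x v IHv] s e.
  move=> _; rewrite /= add0n; case: s => [|s].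
    rewrite shuffle_weight0 mul1r mul1r add0n; case: e => [|e] /=.
      by rewrite big_cons big_nil eqxx addr0.
    by rewrite big_nil.
  by rewrite /= big_nil /shuffle_weight epow0S !(mulr0, mul0r).
case/andP=> ltxM ltvM; have {}IHv s' e' := IHv s' e' ltvM.
have bnd b z := @rdes_shuffle_max v b z ltvM (fun b' y => @rdes_shuffle v b' y
  ltvM).
have size_v := rdes_le_size v.
rewrite [shuffle _ _]/= sum_cons_cat.
set D : nat := (head t v < x)%N.
have rE : rdes t (x :: v) = (D + rdes t v)%N by [].
have -> : rmaj t (x :: v) = (D + rdes t v + rmaj t v)%N by [].
rewrite rE [size _]/=.
rewrite (@eq_sum_in (shuffle v _) _ (fun y => rdes t y == rdes t v + s)%N);
  last first.
  by move=> y yv; rewrite (rdes_cons_shuffle _ yv) -addnA eqn_add2l.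
rewrite IHv.
rewrite (@eq_sum_in (shuffle_max _ _) _
    (fun y => rdes t y == rdes t v + (D + s))%N); last first.
  move=> y yv; rewrite (rdes_cons_shuffle_max (ltnW ltxM) yv).
  by rewrite addnCA addnA.
have [-> | ->] : (D = 1 \/ D = 0)%N by rewrite /D; case: (_ < x)%N;
  [left|right].
  rewrite !add1n subSS shuffle_weightSk !addSn !exprS ?exprD.
  case: e => [|e].
    rewrite sum_in0 ?hpow0; first by ring.
    move=> y y_max /=; have := bnd _ _ y_max; case: eqP => //; lia.
  rewrite addnS -addSn sum_shuffle_max // !addnS hpowS !exprS ?exprD; ring.
rewrite !add0n subSn //; case: s => [|s].
  (* For [s = 0] no word in [shuffle_max] qualifies, as it has more descents than [v]. *)
  rewrite sum_in0 ?shuffle_weight0; first by rewrite !addn0 addr0 exprD; ring.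
  move=> y y_max /=; have := bnd _ _ y_max; case: eqP => //; lia.
by rewrite sum_shuffle_max // shuffle_weightS !exprD !exprS; ring.
Qed.

End Descents.
End Shuffles.

(** * Characterization of the shuffles *)

Section ShuffleMembership.

Variables M t : nat.
Hypothesis lt_tM : t < M.
Implicit Types (v z : seq nat) (b : nat).

Let is_shuffle v b z :=
  [&& [seq x <- z | x < M] == v, count_mem M z == b & all (fun x => x <= M) z].

Lemma mem_map_cons x y z (A : seq (seq nat)) :
  (y :: z \in [seq x :: u | u <- A]) = (y == x) && (z \in A).
Proof.
apply/mapP/andP=> [[u uA [-> ->]] | [/eqP-> zA]]; first by rewrite eqxx.
by exists z.
Qed.

(** The two lists are defined through each other, so one induction on [z] treats both. As [t < M],
    the empty word counts as not beginning with [M]. *)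
Lemma mem_shuffle_both v b z : all (fun x => x < M) v ->
  (z \in shuffle M v b) = is_shuffle v b z && (head t z != M) /\
  (z \in shuffle_max M (shuffle M v) b) = is_shuffle v b z && (head t z == M).
Proof.
rewrite /is_shuffle; elim: z v b => [|y z IHz] v b ltvM.
  rewrite (ltn_eqF lt_tM) /= andbT andbF; split.
    case: v {ltvM} => [|x v] /=; first by case: b.
    by apply/negP => /mapP[].
  by case: b => //= b; apply/negP => /mapP[].
split.
  case: v ltvM => [|x v] /= ltvM.
    rewrite [LHS](_ : _ = false); last by case: b.
    by case: (ltngtP y M) => //=; rewrite ?andbF.
  case/andP: ltvM => ltxM ltvM; rewrite mem_map_cons mem_cat.
  have [-> ->] := IHz v b ltvM; rewrite -andb_orr orNb andbT.
  case: (ltngtP y M) => [lt_yM|lt_My|->] /=; rewrite ?andbF //.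
  - by rewrite add0n eqseq_cons andbT andbA.
  - by rewrite gtn_eqF // (ltn_trans ltxM).
  - by rewrite gtn_eqF.
case: b => [|b] /=; first by case: (ltngtP y M) => //=; rewrite ?andbF.
rewrite mem_map_cons mem_cat; have [-> ->] := IHz v b ltvM.
rewrite -andb_orr orbN andbT.
by case: (ltngtP y M) => //=; rewrite ?andbF ?add1n ?eqSS ?andbT.
Qed.

Lemma mem_shuffle v b z : all (fun x => x < M) v ->
  (z \in shuffle M v b) =
    [&& [seq x <- z | x < M] == v, count_mem M z == b,
        all (fun x => x <= M) z & head t z != M].
Proof. by move=> /mem_shuffle_both H; have [-> _] := H b z;
  rewrite -!andbA. Qed.

Lemma uniq_shuffle v b : all (fun x => x < M) v -> uniq (shuffle M v b).
Proof.
have disj u i : all (fun x => x < M) u ->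
    has (mem (shuffle M u i)) (shuffle_max M (shuffle M u) i) = false.
  move=> ltuM; apply/negbTE/hasPn => z zm; apply/negP => zs.
  have [e1 e2] := mem_shuffle_both i z ltuM.
  have {}zs : z \in shuffle M u i := zs.
  by move: zs zm; rewrite e1 e2 => /andP[_ /negbTE->]; rewrite andbF.
have cons_inj x : injective (cons x : seq nat -> seq nat) by move=> ? ? [].
elim: v b => [|x v IHv] b; first by case: b.
case/andP=> _ ltvM; rewrite /= map_inj_uniq // cat_uniq IHv // disj //=.
elim: b => [//|b IHb].
by rewrite /= map_inj_uniq // cat_uniq IHb has_sym disj // IHv.
Qed.

End ShuffleMembership.

(** * Words that begin with their least letter *)

Lemma iota1S m : iota 1 m.+1 = rcons (iota 1 m) m.+1.
Proof. by rewrite -[X in iota 1 X]addn1 iotaD cats1. Qed.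

Lemma content_rcons m w :
  content m.+1 w = rcons (content m w) (count_mem m.+1 w).
Proof. by rewrite /content iota1S map_rcons. Qed.

Lemma CDT_rcons m w :
  CDT m.+1 w = rcons (CDT m w)
    ((cdes (subword_le m.+1 w))%:Z - (cdes (subword_le m w))%:Z)%R.
Proof. by rewrite /CDT iota1S map_rcons. Qed.

Lemma subword_le_id m w : all (fun x => x <= m) w -> subword_le m w = w.
Proof. by move/all_filterP. Qed.

Lemma subword_le_sub i m w : i <= m ->
  subword_le i (subword_le m w) = subword_le i w.
Proof.
move=> le_im; rewrite /subword_le -filter_predI; apply: eq_filter => x /=.
by case: leqP => // le_xi; rewrite (leq_trans le_xi).
Qed.

Lemma content_subword m w : content m (subword_le m w) = content m w.
Proof.
apply/eq_in_map => j; rewrite mem_iota add1n ltnS => /andP[_ le_jm].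
rewrite count_filter; apply: eq_count => x /=.
by case: eqP => // ->; rewrite le_jm.
Qed.

Lemma CDT_subword m w : CDT m (subword_le m w) = CDT m w.
Proof.
apply/eq_in_map => j; rewrite mem_iota add1n ltnS => /andP[_ le_jm].
by rewrite !subword_le_sub // (leq_trans (leq_pred _)).
Qed.

Lemma size_content m w : is_word w -> all (fun x => x <= m) w ->
  sumn (content m w) = size w.
Proof.
rewrite /content sumnE big_map; elim: w => [|x w IHw] /=.
  by rewrite big1.
case/andP=> x_gt0 ww /andP[le_xm lewm]; rewrite big_split /= IHw //.
rewrite -[(size w).+1]add1n; congr (_ + _).
transitivity (count_mem x (iota 1 m)).
  by rewrite -sum1_count [RHS]big_mkcond; apply: eq_bigr => j _ /=;
    rewrite [j == x]eq_sym; case: eqP.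
by rewrite count_uniq_mem ?iota_uniq // mem_iota x_gt0 add1n ltnS le_xm.
Qed.

(** [content] ignores letters above [size alpha], hence the separate bound on the letters. *)
Definition min_word (alpha delta : seq nat) (w : seq nat) : bool :=
  [&& is_word w, all (fun x => x <= size alpha) w,
      content (size alpha) w == alpha,
      CDT (size alpha) w == map Posz delta & all (fun x => head 0 w <= x) w].

Definition all_words n m : seq (seq nat) :=
  [seq word_of w | w <- enum {: wordType n m}].

Lemma word_of_inj n m : injective (@word_of n m).
Proof. by move=> u v /(inj_map val_inj) /val_inj. Qed.

Lemma uniq_all_words n m : uniq (all_words n m).
Proof. by rewrite map_inj_uniq ?enum_uniq //; apply: word_of_inj. Qed.

Lemma mem_all_words n m w :
  (w \in all_words n m) = (size w == n) && all (fun x => x <= m) w.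
Proof.
apply/mapP/andP => [[u _ ->] | [size_w le_wm]].
  rewrite size_map size_tuple eqxx; split=> //.
  by apply/allP => x /mapP[i _ ->]; apply: (ltn_ord i).
have size_u : size [seq inord x : 'I_m.+1 | x <- w] == n by rewrite size_map.
exists (Tuple size_u); first by rewrite mem_enum.
rewrite /word_of /= -map_comp -[LHS]map_id; apply/eq_in_map => x xw /=.
by rewrite inordK // ltnS (allP le_wm).
Qed.

Definition min_words (alpha delta : seq nat) : seq (seq nat) :=
  [seq w <- all_words (sumn alpha) (size alpha) | min_word alpha delta w].

Lemma uniq_min_words alpha delta : uniq (min_words alpha delta).
Proof. exact/filter_uniq/uniq_all_words. Qed.

Lemma mem_min_words alpha delta w :
  (w \in min_words alpha delta) = min_word alpha delta w.
Proof.
rewrite mem_filter andb_idr // => /and5P[w_pos le_w /eqP cont_w _ _].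
by rewrite mem_all_words le_w -[sumn _](congr1 sumn cont_w) size_content ?eqxx.
Qed.

Lemma subword_le0 w : is_word w -> subword_le 0 w = [::].
Proof. by elim: w => [//|[|x] w IHw] //= /IHw. Qed.

(** The entries of [CDT] telescope down to the empty word [subword_le 0 w]. *)
Lemma cdes_subword_le m w delta : is_word w -> size delta = m ->
  CDT m w = map Posz delta -> cdes (subword_le m w) = sumn delta.
Proof.
move=> w_pos; elim: m delta => [|m IHm] delta.
  by move/size0nil => -> _; rewrite subword_le0 // cdesE.
case/lastP: delta => [//|delta s]; rewrite size_rcons => -[size_delta].
rewrite CDT_rcons map_rcons => /eqP; rewrite eqseq_rcons => /andP[/eqP cdt_w].
by rewrite (IHm _ size_delta cdt_w) sumn_rcons => /eqP; lia.
Qed.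

Lemma size_min_word alpha delta w : min_word alpha delta w -> size w = sumn
  alpha.
Proof. by case/and5P=> w_pos le_w /eqP cont_w _ _;
  rewrite -(size_content w_pos le_w) cont_w. Qed.

Lemma cdes_min_word alpha delta w : size delta = size alpha ->
  min_word alpha delta w -> cdes w = sumn delta.
Proof.
move=> size_delta /and5P[w_pos le_w _ /eqP cdt_w _].
by rewrite -(subword_le_id le_w); apply: cdes_subword_le.
Qed.

(** Since [sumn alpha] is positive, a word [z] of this content has a letter below the new largest
    one; so it begins with its least letter exactly if [v] does and [z] does not begin with the new
    letter. *)
Lemma min_word_rcons alpha delta a s z :
    size delta = size alpha -> 0 < sumn alpha ->
  let v := subword_le (size alpha) z in
  min_word (rcons alpha a) (rcons delta s) z =
    [&& min_word alpha delta v, z \in shuffle (size alpha).+1 v a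
      & cdes z == cdes v + s].
Proof.
move=> size_delta alpha_gt0 v; set m := size alpha.
have ltvM : all (fun x => x < m.+1) v by apply: filter_all.
rewrite (@mem_shuffle m.+1 0) // /min_word size_rcons -/m.
rewrite content_rcons CDT_rcons map_rcons !eqseq_rcons content_subword
  CDT_subword.
rewrite -[[seq x <- z | _]]/v eqxx -/m.
have -> : all (leq^~ m) v by apply: filter_all.
have [le_z|] := boolP (all (leq^~ m.+1) z); last by rewrite !andbF.
rewrite subword_le_id // -/v /=.
have -> : ((cdes z)%:Z - (cdes v)%:Z == s :> int)%R = (cdes z == cdes v + s).
  by apply/eqP/eqP; lia.
case: (cdes z == _) => /=; rewrite ?andbT ?andbF //.
case: (count_mem m.+1 z == a) => /=; rewrite ?andbT ?andbF //.
case: (CDT m z == _) => /=; rewrite ?andbT ?andbF //.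
have [cont_z|] := boolP (content m z == alpha); last by rewrite !andbF.
have vn0 : is_word v -> v != [::].
  move=> v_pos; apply: contraL alpha_gt0 => /eqP v0.
  rewrite -(eqP cont_z) -content_subword -/v size_content ?v0 //.
rewrite -[in RHS]andbA /=.
have in_v x : x \in z -> x <= m -> x \in v by rewrite mem_filter => -> ->.
have head_v : head 0 z <= m -> z != [::] -> head 0 v = head 0 z.
  by rewrite /v; case: (z) => [//|y z'] /= ->.
have [z0|zn0] := eqVneq z [::].
  by have := vn0; rewrite /v z0 => /(_ isT).
apply/andP/and3P => [[z_pos minz] | [v_pos minv hz]].
  have v_pos : is_word v by apply/allP => x /(mem_subseq (filter_subseq _ _))
    /(allP z_pos).
  have le_hz : head 0 z <= m.
    case E : v (vn0 v_pos) => [//|x v'] _; have : x \in v by rewrite E mem_head.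
    by rewrite mem_filter => /andP[le_xm /(allP minz)] /leq_trans->.
  rewrite v_pos (head_v le_hz zn0) neq_ltn ltnS le_hz; split=> //.
  by apply/allP => x /(mem_subseq (filter_subseq _ _)) /(allP minz).
have le_hz : head 0 z <= m.
  have : head 0 z <= m.+1 by apply: (allP le_z); case: (z) zn0 => // y z' _;
    apply: mem_head.
  by rewrite leq_eqVlt (negbTE hz).
split; apply/allP => x xz; case: (leqP x m) => [le_xm|lt_mx].
- exact: (allP v_pos _ (in_v _ xz le_xm)).
- exact: leq_ltn_trans lt_mx.
- by rewrite -(head_v le_hz zn0); apply: (allP minv _ (in_v _ xz le_xm)).
- exact: leq_trans le_hz (ltnW lt_mx).
Qed.

Lemma map_const_in (T U : eqType) (f : T -> U) c s :
  {in s, forall x, f x = c} -> map f s = nseq (size s) c.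
Proof.
by move=> fc; rewrite -(size_map f s); apply/all_pred1P; rewrite all_map;
  apply/allP => x /fc /= ->.
Qed.

Lemma CDT_nseq m a x : CDT m (nseq a x) = nseq m 0%R.
Proof.
rewrite /CDT -[in RHS](size_iota 1 m); apply: map_const_in => j _.
by rewrite /subword_le !filter_nseq !cdes_nseq subrr.
Qed.

Lemma content_nseq m a : content m.+1 (nseq a m.+1) = rcons (nseq m 0) a.
Proof.
rewrite content_rcons count_nseq /= eqxx mul1n; congr rcons.
rewrite /content -[in RHS](size_iota 1 m); apply: map_const_in => j.
rewrite mem_iota add1n ltnS => /andP[_ le_jm].
by rewrite count_nseq /= gtn_eqF ?ltnS.
Qed.

(** In the case that [min_word_rcons] leaves out, the word is constant and has no cyclic
    descents. *)
Lemma min_word_zero alpha delta a s z :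
    size delta = size alpha -> sumn alpha = 0 ->
  min_word (rcons alpha a) (rcons delta s) z =
    (z == nseq a (size alpha).+1) && (sumn (rcons delta s) == 0).
Proof.
move=> size_delta alpha0;
  have /natnseq0P alphaE : sumn alpha == 0 by rewrite alpha0.
set M := (size alpha).+1.
have cdt0 : (CDT M (nseq a M) == map Posz (rcons delta s)) = (sumn (rcons delta
  s) == 0).
  rewrite CDT_nseq; apply/eqP/natnseq0P => [H | ->].
    apply: (inj_map (f := Posz)); first by move=> ? ? [].
    by rewrite -H map_nseq size_rcons size_delta.
  by rewrite map_nseq size_rcons size_delta.
have [->|zN] /= := eqVneq z (nseq a M).
  rewrite /min_word size_rcons -/M cdt0 content_nseq -alphaE eqxx /is_word.
  rewrite !all_nseq leqnn !orbT /= [X in _ && X](_ : _ = true) ?andbT //.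
  by case: (a) => //= a'; rewrite leqnn.
apply: contraNF zN => w_min; have size_z := size_min_word w_min.
move: w_min; rewrite /min_word size_rcons -/M => /and5P[z_pos le_z cont_z _ _].
rewrite sumn_rcons alpha0 add0n in size_z; rewrite -size_z.
apply/eqP/all_pred1P/allP => x xz /=; rewrite eqn_leq (allP le_z) //= ltnNge.
apply/negP => le_xm; move: cont_z;
  rewrite content_rcons eqseq_rcons => /andP[/eqP cont_z _].
have : x \in subword_le (size alpha) z by rewrite mem_filter le_xm.
suff /eqP/nilP-> : size (subword_le (size alpha) z) = 0 by [].
rewrite -(@size_content (size alpha)) ?content_subword ?cont_z //.
  by apply/allP => y /(mem_subseq (filter_subseq _ _)) /(allP z_pos).
exact: filter_all.
Qed.

(** * Generating functions of the words that begin with their least letter *)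

Section MinGenfun.
Local Open Scope ring_scope.
Variable F : fieldType.
Implicit Type q : F.

(** The insertion formula holds for [rmaj] at every [q]; the powers with [rmaj] and [maj] agree once
    [q ^+ size w = 1]. *)
Definition min_genfun q alpha delta : F :=
  \sum_(w <- min_words alpha delta) q ^+ rmaj (head 0%N w) w.

Lemma min_genfun1 alpha delta :
  min_genfun 1 alpha delta = (size (min_words alpha delta))%:R.
Proof.
rewrite /min_genfun; under eq_bigr do rewrite expr1n.
by rewrite big_const_seq count_predT iter_addr_0.
Qed.

(** The words are grouped by the subword [v] of smaller letters; [sum_shuffle] gives each group the
    same factor, since [alpha] and [delta] fix the length and the cyclic descents of [v]. *)
Lemma min_genfun_rcons q alpha delta a s :
    size delta = size alpha -> (0 < sumn alpha)%N ->
  min_genfun q (rcons alpha a) (rcons delta s) =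
    min_genfun q alpha delta *
    (if (s <= a)%N then
       shuffle_weight q (sumn alpha - sumn delta) (sumn delta) s
         * hpow q (sumn delta + s) (a - s)
     else 0).
Proof.
move=> size_delta alpha_gt0.
set T := fun v => [seq z <- shuffle (size alpha).+1 v a | cdes z == (cdes v +
  s)%N].
have E : perm_eq (min_words (rcons alpha a) (rcons delta s))
    [seq z | v <- min_words alpha delta, z <- T v].
  have T_sub v z : v \in min_words alpha delta -> z \in T v ->
      subword_le (size alpha) z = v.
    rewrite mem_min_words mem_filter => /and5P[_ le_v _ _ _] /andP[_].
    by rewrite (@mem_shuffle _ 0) // => /and4P[/eqP].
  apply: uniq_perm; first exact: uniq_min_words.
    apply: allpairs_uniq_dep; first exact: uniq_min_words.
      move=> v; rewrite mem_min_words => /and5P[_ le_v _ _ _].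
      by apply/filter_uniq/(@uniq_shuffle _ 0).
    move=> _ _ /allpairsPdep[v [z [vm zv ->]]] /allpairsPdep[v' [z' [vm' zv'
      ->]]] /= zz'.
    by rewrite -(T_sub _ _ vm zv) -(T_sub _ _ vm' zv') zz'.
  move=> z; rewrite mem_min_words min_word_rcons //.
  apply/and3P/allpairsPdep => [[v_min zs cz] | [v [z' [vm zv ->]]]].
    by exists (subword_le (size alpha) z), z;
      rewrite mem_min_words mem_filter cz.
  rewrite (T_sub _ _ vm zv); move: zv; rewrite mem_filter => /andP[-> ->].
  by rewrite -mem_min_words vm.
rewrite /min_genfun (perm_big _ E) big_allpairs_dep /= mulr_suml.
rewrite big_seq [RHS]big_seq; apply: eq_bigr => v;
  rewrite mem_min_words => v_min.
have size_v := size_min_word v_min.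
have cdes_v := cdes_min_word size_delta v_min.
case/and5P: v_min => _ le_v _ _ _.
have ltvM : all (fun x => x < (size alpha).+1)%N v by [].
have lt_t : (head 0%N v < (size alpha).+1)%N by apply: head_lt.
have head_z z : z \in shuffle (size alpha).+1 v a -> head 0%N z = head 0%N v.
  exact: head_shuffle.
have rdes_v : rdes (head 0%N v) v = sumn delta by rewrite -cdesE.
rewrite /T big_filter -size_v -rdes_v.
transitivity (\sum_(z <- shuffle (size alpha).+1 v a
    | rdes (head 0%N v) z == (rdes (head 0%N v) v + s)%N) q ^+ rmaj (head 0%N
      v) z).
  rewrite big_seq_cond [RHS]big_seq_cond; apply: eq_big => z.
    by case: (boolP (z \in _)) => //= /head_z hz; rewrite !cdesE hz.
  by case/andP => /head_z-> _.
case: leqP => [le_sa|lt_as]; last first.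
  (* Fewer than [s] inserted letters cannot create [s] descents. *)
  rewrite mulr0 sum_in0 // => z /(rdes_shuffle lt_t ltvM) /=; case: eqP => //;
    lia.
by rewrite -{1}(subnKC le_sa) sum_shuffle // mulrA.
Qed.

End MinGenfun.

Lemma sumn_divn d s : all (dvdn d) s -> sumn [seq x %/ d | x <- s] = sumn s %/
  d.
Proof.
elim: s => [|x s IHs] /=; first by rewrite div0n.
by case/andP=> dx ds; rewrite IHs // divnDl.
Qed.

Lemma dvdn_sumn d s : all (dvdn d) s -> d %| sumn s.
Proof. by elim: s => [|x s IHs] //= /andP[dx /IHs ds]; rewrite dvdn_add. Qed.

Lemma all_dvdn0 d s : sumn s = 0 -> all (dvdn d) s.
Proof. by move=> /eqP/natnseq0P->; rewrite all_nseq dvdn0 orbT. Qed.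

(** * Values of these generating functions at roots of unity *)

Section MinGenfunRootOfUnity.
Local Open Scope ring_scope.
Variable F : fieldType.

Lemma min_genfun_nil (q : F) : min_genfun q [::] [::] = 1.
Proof.
have E : perm_eq (min_words [::] [::]) [:: [::]].
  apply: uniq_perm => [||w]; rewrite ?uniq_min_words // mem_min_words inE.
  by case: w => [|[|x] w]; rewrite /min_word /= ?andbF.
by rewrite /min_genfun (perm_big _ E) big_seq1.
Qed.

Lemma min_genfun_zero (q : F) alpha delta a s :
    size delta = size alpha -> sumn alpha = 0%N ->
  min_genfun q (rcons alpha a) (rcons delta s) = (sumn (rcons delta s) ==
    0%N)%:R.
Proof.
move=> size_delta alpha0; rewrite /min_genfun.
have E : perm_eq (min_words (rcons alpha a) (rcons delta s))
    (if sumn (rcons delta s) == 0%N then [:: nseq a (size alpha).+1] else [::]).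
  apply: uniq_perm => [||w]; rewrite ?uniq_min_words ?mem_min_words //;
    first by case: ifP.
  by rewrite min_word_zero //; case: ifP; rewrite ?inE ?andbT ?andbF.
rewrite (perm_big _ E); case: ifP => _; last by rewrite big_nil.
rewrite big_seq1; case: (a) => [//|a']; rewrite rmaj_nseq //.
Qed.

(** Since [d] divides [k], the factor [z ^+ (k * s)] is 1, and [expr_bin2_prim_root] removes the
    sign from [epow_prim_root]. *)
Lemma shuffle_weight_prim_root (z : F) d N k s : d.-primitive_root z ->
    (d %| N)%N -> (d %| k)%N ->
  shuffle_weight z N k s =
    if (d %| s)%N then shuffle_weight 1 (N %/ d) (k %/ d) (s %/ d) else 0.
Proof.
move=> prim_z dN dk; rewrite /shuffle_weight expr1n mul1r.
rewrite -{1}(divnK dN) [(_ %/ _ * d)%N]mulnC (epow_prim_root prim_z).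
case: ifP => [ds|]; last by rewrite mulr0.
have zks : z ^+ (k * s) = 1.
  by rewrite -(divnK dk) mulnAC mulnC exprM (prim_expr_order prim_z) expr1n.
rewrite exprD zks mul1r mulrA -{1}(divnK ds) [(_ * d)%N]mulnC.
by rewrite expr_bin2_prim_root // mul1r.
Qed.

(* Write [l, k] for the sums of [alpha, delta] and [a, s] for the last entries.
   As [d] divides [k + s], the factor [hpow] vanishes unless [d] divides
   [a - s]; then [d] divides [l - k], and [epow] vanishes unless [d] divides
   [s]. *)
Lemma min_genfun_prim_root (z : F) d alpha delta : d.-primitive_root z ->
    size delta = size alpha -> (d %| sumn alpha)%N -> (d %| sumn delta)%N ->
  min_genfun z alpha delta =
    if all (dvdn d) alpha && all (dvdn d) delta then
      min_genfun 1 [seq (x %/ d)%N | x <- alpha] [seq (x %/ d)%N | x <- delta]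
    else 0.
Proof.
move=> prim_z; have d_gt0 := prim_order_gt0 prim_z.
elim/last_ind: alpha delta => [|alpha a IH] delta.
  by move/size0nil => -> _ _; rewrite !min_genfun_nil.
case/lastP: delta => [|delta s]; first by rewrite size_rcons.
rewrite !size_rcons !all_rcons !map_rcons => -[size_delta] dal dde.
have [alpha0|alpha_gt0] := posnP (sumn alpha).
  rewrite min_genfun_zero // min_genfun_zero ?size_map //; last first.
    by rewrite sumn_divn ?all_dvdn0 // alpha0 div0n.
  rewrite sumn_rcons alpha0 add0n in dal.
  rewrite dal (all_dvdn0 _ alpha0) -all_rcons -map_rcons /=.
  case: eqP => [de0|/eqP de0]; case: ifP => // d_de.
  - by rewrite sumn_divn // de0 div0n eqxx.
  - by rewrite (all_dvdn0 _ de0) in d_de.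
  rewrite sumn_divn // -[(_ %/ _ == 0)%N]leqn0 [(_ %/ _ <= 0)%N]leqNgt.
  by rewrite divn_gt0 // dvdn_leq ?lt0n // dvdn_sumn.
rewrite min_genfun_rcons //; rewrite !sumn_rcons in dal dde.
set l := sumn alpha in alpha_gt0 dal *; set k := sumn delta in dde *.
have [dall|/negbTE ndall] := boolP ((d %| a)%N && all (dvdn d) alpha
  && ((d %| s)%N && all (dvdn d) delta)); last first.
  case: leqP => [le_sa|_]; last by rewrite mulr0.
  rewrite -[(k + s)%N](divnK dde) [(_ %/ _ * d)%N]mulnC (hpow_prim_root _ _
    prim_z).
  case: ifP => [d_as|]; last by rewrite !mulr0.
  (* Without words for [alpha] and [delta] the sum is empty; otherwise a word provides [k <= l], so
     that [l - k] is not truncated. *)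
  have [no_word|] := eqVneq (min_words alpha delta) [::].
    by rewrite /min_genfun no_word big_nil mul0r.
  case E : (min_words alpha delta) => [//|w ws] _.
  have w_min : min_word alpha delta w by rewrite -mem_min_words E mem_head.
  have le_kl : (k <= l)%N.
    rewrite /k /l -(size_min_word w_min) -(cdes_min_word size_delta w_min)
      cdesE.
    exact: rdes_le_size.
  have d_lk : (d %| l - k)%N.
    have : (d %| (l - k) + (a - s))%N.
      by rewrite (_ : (_ + _ = (l + a) - (k + s))%N) ?dvdn_sub //; lia.
    by rewrite dvdn_addl.
  have [ds|nds] := boolP (d %| s)%N; last first.
    rewrite /shuffle_weight -{1}(divnK d_lk) [(_ %/ _ * d)%N]mulnC
      (epow_prim_root prim_z) (negbTE nds).
    by rewrite !mulr0 mul0r mulr0.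
  have dk : (d %| k)%N by rewrite -(dvdn_addl k ds).
  have da : (d %| a)%N by rewrite -(subnK le_sa) dvdn_add.
  have dl : (d %| l)%N by rewrite -(dvdn_addl l da).
  rewrite IH //; case: ifP => [|_]; last by rewrite mul0r.
  by move: ndall; rewrite da ds /= => ->.
case/andP: dall => /andP[da dalpha] /andP[ds ddelta].
have dl : (d %| l)%N by apply: dvdn_sumn.
have dk : (d %| k)%N by apply: dvdn_sumn.
rewrite IH // dalpha ddelta min_genfun_rcons ?size_map //; last first.
  by rewrite sumn_divn // divn_gt0 // dvdn_leq.
congr (_ * _); rewrite !sumn_divn // -/l -/k leq_divRL // divnK //.
case: leqP => // le_sa.
rewrite (shuffle_weight_prim_root _ prim_z) ?dvdn_sub // ds divnBr //.
rewrite -[(k + s)%N](divnK dde) [(_ %/ _ * d)%N]mulnC (hpow_prim_root _ _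
  prim_z).
by rewrite dvdn_sub // divnBr // divnDl.
Qed.

End MinGenfunRootOfUnity.

(** * Powers of words *)

Definition wpow (T : Type) d (u : seq T) : seq T := flatten (nseq d u).

Lemma wpowS (T : Type) d (u : seq T) : wpow d.+1 u = u ++ wpow d u.
Proof. by []. Qed.

Lemma wpowSr (T : Type) d (u : seq T) : wpow d.+1 u = wpow d u ++ u.
Proof.
elim: d => [|d IHd]; first by rewrite /wpow /= cats0.
by rewrite wpowS {1}IHd catA.
Qed.

Lemma rot_wpow (T : Type) d (u : seq T) : rot (size u) (wpow d u) = wpow d u.
Proof.
case: d => [|d]; first by rewrite /wpow /= /rot; case: (size u).
by rewrite {1}wpowS rot_size_cat wpowSr.
Qed.

(** With [u] the prefix of length [g] and [v] the rest, invariance says that [u ++ v = v ++ u];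
    comparing prefixes splits one copy of [u] after another off [v]. *)
Lemma rot_fixed_wpow (T : eqType) g d (w : seq T) : size w = g * d -> 0 < d ->
  rot g w = w -> w = wpow d (take g w).
Proof.
case: d => // d size_w _ rot_w; set u := take g w.
have size_u : size u = g by rewrite size_takel // size_w mulnS leq_addr.
have size_v : size (drop g w) = g * d by rewrite size_drop size_w mulnS addKn.
have comm : u ++ drop g w = drop g w ++ u by rewrite cat_take_drop -[LHS]rot_w.
rewrite -[LHS](cat_take_drop g) -/u wpowS; congr (_ ++ _).
elim: d (drop g w) size_v comm {size_w} => [|d IHd] v size_v comm.
  by apply: size0nil; rewrite size_v muln0.
have uv : u = take g v.
  have := congr1 (take g) comm; rewrite -{1}size_u take_size_cat // => ->.
  by rewrite takel_cat // size_v mulnS leq_addr.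
have size_v' : size (drop g v) = g * d by rewrite size_drop size_v mulnS addKn.
have vE : v = u ++ drop g v by rewrite uv cat_take_drop.
move: (drop g v) size_v' vE => v' size_v' vE.
rewrite vE wpowS; congr (_ ++ _); apply: IHd => //.
by move: comm; rewrite vE -catA => /eqP; rewrite eqseq_cat // => /andP[_ /eqP].
Qed.

Lemma count_wpow (T : Type) (p : pred T) d u : count p (wpow d u) = d * count p
  u.
Proof. by elim: d => //= d IHd; rewrite wpowS count_cat IHd mulSn. Qed.

Lemma filter_wpow (T : Type) (p : pred T) d u :
  filter p (wpow d u) = wpow d (filter p u).
Proof. by elim: d => //= d IHd; rewrite !wpowS filter_cat IHd. Qed.

Lemma all_wpow (T : Type) (p : pred T) d u : 0 < d -> all p (wpow d u) = all p
  u.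
Proof.
case: d => // d _; elim: d => [|d IHd]; first by rewrite /wpow /= cats0.
by rewrite wpowS all_cat IHd andbb.
Qed.

Lemma head_wpow (T : Type) (x : T) d u : 0 < d -> head x (wpow d u) = head x u.
Proof. by case: d => // d _; case: u => [|y u] //; rewrite /wpow; elim: d. Qed.

(** Every copy of [u] is followed by the first letter of [u], that of the next copy or, cyclically,
    of the first. *)
Lemma cdes_wpow d u : cdes (wpow d u) = d * cdes u.
Proof.
case: d => [|d]; first by rewrite cdesE.
rewrite !cdesE head_wpow //; set h := head 0 u.
elim: (d.+1) => [//|e IHe]; rewrite wpowS rdes_cat IHe mulSn;
  congr (rdes _ _ + _).
by rewrite /h; case: e {IHe} => // e; rewrite -[RHS](@head_wpow _ _ e.+1) //;
  case: (u).
Qed.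

Lemma map_muln_eq d s t : 0 < d ->
  (map (muln d) s == t) = all (dvdn d) t && (s == [seq x %/ d | x <- t]).
Proof.
move=> d_gt0; elim: s t => [|x s IHs] [|y t] //=; first by rewrite andbF.
rewrite !eqseq_cons IHs andbACA; congr (_ && _).
by apply/eqP/andP=> [<-|[dy /eqP->]]; rewrite ?dvdn_mulr ?mulKn // mulnC divnK.
Qed.

Lemma content_wpow m d u : content m (wpow d u) = map (muln d) (content m u).
Proof. by rewrite -map_comp; apply: eq_map => j; apply: count_wpow. Qed.

Lemma CDT_wpow m d u :
  CDT m (wpow d u) = map (GRing.mul d%:Z) (CDT m u).
Proof.
rewrite -map_comp; apply: eq_map => j.
by rewrite /subword_le !filter_wpow !cdes_wpow /= !PoszM mulrBr.
Qed.

Lemma map_mulz_eq d (s : seq int) t : 0 < d ->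
  (map (GRing.mul d%:Z) s == map Posz t)
    = all (dvdn d) t && (s == map Posz [seq x %/ d | x <- t]).
Proof.
move=> d_gt0; elim: s t => [|x s IHs] [|y t] //=; first by rewrite andbF.
rewrite !eqseq_cons IHs andbACA; congr (_ && _).
apply/eqP/andP=> [xy|[dy /eqP->]]; last by rewrite -PoszM mulnC divnK.
case: x xy => [x|x] xy; last by nia.
move: xy; rewrite -PoszM => -[<-]; by rewrite dvdn_mulr // mulKn.
Qed.

Lemma min_word_wpow alpha delta d u : 0 < d ->
  min_word alpha delta (wpow d u) =
    [&& all (dvdn d) alpha, all (dvdn d) delta
      & min_word [seq x %/ d | x <- alpha] [seq x %/ d | x <- delta] u].
Proof.
move=> d_gt0; rewrite /min_word /is_word !all_wpow // head_wpow // size_map.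
rewrite content_wpow map_muln_eq // CDT_wpow map_mulz_eq //.
by do 2 case: (all (dvdn d) _); rewrite ?andbF.
Qed.

(** [wpow d] is a bijection from the words for the divided sequences onto the words fixed by
    [rot g]; its inverse is [take g]. *)
Lemma count_min_words_rot alpha delta g d : 0 < d -> g * d = sumn alpha ->
  count (fun w => rot g w == w) (min_words alpha delta) =
    if all (dvdn d) alpha && all (dvdn d) delta then
      size (min_words [seq x %/ d | x <- alpha] [seq x %/ d | x <- delta])
    else 0.
Proof.
move=> d_gt0 gd.
have fixedE w : w \in [seq w <- min_words alpha delta | rot g w == w] ->
    w = wpow d (take g w).
  rewrite mem_filter mem_min_words => /andP[/eqP rot_w /size_min_word size_w].
  by apply: rot_fixed_wpow; rewrite ?size_w.
rewrite -size_filter; case: ifP => [/andP[da dd] | ndvd]; last first.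
  case E : [seq w <- _ | _] => [//|w ws];
    have : w \in w :: ws by apply: mem_head.
  rewrite -E => w_fixed; move: (w_fixed); rewrite mem_filter mem_min_words.
  by case/andP=> _; rewrite (fixedE _ w_fixed) min_word_wpow // andbA ndvd.
have size_u u : u \in min_words [seq x %/ d | x <- alpha] [seq x %/ d | x <-
  delta] ->
    size u = g.
  by rewrite mem_min_words => /size_min_word->; rewrite sumn_divn // -gd mulnK.
rewrite -[RHS](size_map (wpow d)); apply/perm_size/uniq_perm.
- exact/filter_uniq/uniq_min_words.
- rewrite map_inj_in_uniq ?uniq_min_words // => u v /size_u gu /size_u gv.
  case: (d) d_gt0 => // e _ /eqP; rewrite !wpowS eqseq_cat ?gu ?gv //.
  by case/andP=> /eqP.
move=> w; apply/idP/mapP => [w_fixed | [u u_min ->]].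
  exists (take g w); last exact: fixedE.
  move: (w_fixed); rewrite mem_filter !mem_min_words => /andP[_].
  by rewrite {1}(fixedE _ w_fixed) min_word_wpow // da dd.
rewrite mem_filter mem_min_words min_word_wpow // da dd -mem_min_words u_min.
by rewrite -(size_u _ u_min) rot_wpow eqxx.
Qed.

(** * Rotation and cyclic sieving *)

Lemma rot_all_words i n m w : (rot i w \in all_words n m) = (w \in all_words n
  m).
Proof.
rewrite !mem_all_words size_rot; congr (_ && _).
by apply: eq_all_r => x; rewrite mem_rot.
Qed.

Lemma perm_rot_all_words i n m :
  perm_eq [seq rot i w | w <- all_words n m] (all_words n m).
Proof.
apply: uniq_perm; rewrite ?uniq_all_words //.
  by rewrite map_inj_uniq ?uniq_all_words //; apply: rot_inj.
move=> w; apply/mapP/idP => [[u uw ->] | ww]; first by rewrite rot_all_words.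
by exists (rotr i w); rewrite ?rotrK // -(rot_all_words i) rotrK.
Qed.

Lemma rot_invariant (U : Type) (f : seq nat -> U) i w :
  (forall v, f (rot 1 v) = f v) -> f (rot i w) = f w.
Proof.
move=> f_rot; elim: i => [|i IHi]; first by rewrite rot0.
have [lt_i|le_i] := ltnP i (size w); first by rewrite rotS // f_rot.
by rewrite rot_oversize // ltnW.
Qed.

Definition has_min_head (w : seq nat) : bool := all (fun x => head 0 w <= x) w.

Definition word_cdt (alpha delta : seq nat) (w : seq nat) : bool :=
  [&& is_word w, content (size alpha) w == alpha
    & CDT (size alpha) w == map Posz delta].

Lemma content_rot1 m w : content m (rot 1 w) = content m w.
Proof. by apply: eq_map => j; apply/seq.permP; rewrite perm_rot. Qed.

Lemma is_word_rot1 w : is_word (rot 1 w) = is_word w.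
Proof. by apply: eq_all_r => x; rewrite mem_rot. Qed.

Lemma word_cdt_rot1 alpha delta w : word_cdt alpha delta (rot 1 w) = word_cdt
  alpha delta w.
Proof. by rewrite /word_cdt is_word_rot1 content_rot1 CDT_rot1. Qed.

Section RotationSums.
Local Open Scope ring_scope.

Variable F : numFieldType.

(* Double counting of the pairs of a word and an occurrence of its least
   letter. *)
Lemma sum_min_head (P : pred (seq nat)) (f : seq nat -> F) n m c :
    (forall w, P (rot 1 w) = P w) ->
    {in all_words n m, forall w, P w -> f (rot 1 w) = f w} ->
    {in all_words n m, forall w, P w ->
       count (fun x => all (leq x) w) w = c} ->
  c%:R * (\sum_(w <- all_words n m | P w) f w)
    = n%:R * (\sum_(w <- all_words n m | P w && has_min_head w) f w).
Proof.
move=> P_rot f_rot P_count.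
have size_aw w : w \in all_words n m -> size w = n.
  by rewrite mem_all_words => /andP[/eqP].
have f_roti i w : w \in all_words n m -> P w -> f (rot i w) = f w.
  move=> ww Pw; elim: i => [|i IHi]; first by rewrite rot0.
  have [lt_i|le_i] := ltnP i (size w); last by rewrite rot_oversize // ltnW.
  by rewrite rotS // f_rot ?rot_all_words // (rot_invariant i w P_rot).
(* The factor [c] becomes a sum over the positions [i] that carry a least letter. *)
transitivity (\sum_(w <- all_words n m | P w)
    \sum_(i < n) (all (leq (nth 0%N w i)) w)%:R * f w).
  rewrite mulr_sumr big_seq_cond [RHS]big_seq_cond;
    apply: eq_bigr => w /andP[ww Pw].
  rewrite -mulr_suml; congr (_ * _).
  rewrite -(P_count w) // -natr_sum -(size_aw w) // -sum1_count (big_nth 0%N)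
    big_mkord.
  by congr (_%:R); rewrite [LHS]big_mkcond; apply: eq_bigr => i _; case: all.
rewrite exchange_big /=.
transitivity (\sum_(i < n) \sum_(w <- all_words n m | P w && has_min_head w) f
  w).
  (* Rotation by [i] brings the letter at position [i] to the front. *)
  apply: eq_bigr => i _; rewrite -[RHS](perm_big _ (perm_rot_all_words i n m)).
  rewrite [RHS]big_map big_seq_cond [RHS]big_seq_cond.
  rewrite [RHS](eq_bigl (fun w => (w \in all_words n m) && P w && all (leq (nth
    0%N w i)) w)).
    rewrite [RHS]big_mkcondr /=; apply: eq_bigr => w /andP[ww Pw].
    by rewrite f_roti //; case: all; rewrite ?mul1r ?mul0r.
  move=> w /=; case: (boolP (w \in _)) => //= ww;
    rewrite (rot_invariant i w P_rot).
  congr (_ && _); rewrite /has_min_head.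
  have -> : head 0%N (rot i w) = nth 0%N w i.
    by rewrite -nth0 /rot nth_cat size_drop subn_gt0 size_aw // ltn_ord
      nth_drop addn0.
  by apply: eq_all_r => x; rewrite mem_rot.
by rewrite sumr_const card_ord mulr_natl.
Qed.

Lemma perm_eq_content m v w : is_word v -> is_word w ->
    all (fun x => x <= m)%N v -> all (fun x => x <= m)%N w ->
  content m v = content m w -> perm_eq v w.
Proof.
move=> v_pos w_pos le_v le_w cont_vw; apply/allP => x x_vw /=.
have : x \in iota 1 m.
  rewrite mem_iota add1n ltnS; move: x_vw; rewrite mem_cat.
  by case/orP=> xv; rewrite ?(allP v_pos _ xv) ?(allP le_v _ xv)
    ?(allP w_pos _ xv) ?(allP le_w _ xv).
by have /eq_in_map H := cont_vw => /H /eqP.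
Qed.

Lemma exists_min (w : seq nat) : w != [::] -> has (fun x => all (leq x) w) w.
Proof.
case: w => // x w _; elim: w x => [|y w IHw] x; first by rewrite /= leqnn.
have /hasP[u uw /allP u_min] := IHw y.
apply/hasP; have [le_xu|lt_ux] := leqP x u.
  exists x; first exact: mem_head.
  by apply/allP => v; rewrite inE => /predU1P[->|/u_min] //; apply: leq_trans.
exists u; first by rewrite inE uw orbT.
by apply/allP => v; rewrite inE => /predU1P[->|/u_min //]; apply: ltnW.
Qed.

Lemma word_cdt_min_head alpha delta n : n = sumn alpha ->
  perm_eq [seq w <- all_words n (size alpha) | word_cdt alpha delta w &&
    has_min_head w]
    (min_words alpha delta).
Proof.
move=> ->; rewrite /min_words; apply/seq.permP => p; congr (count p _).
apply: eq_in_filter => w; rewrite mem_all_words => /andP[_ le_w].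
by rewrite /min_word le_w /= -!andbA.
Qed.

Lemma expr_rmaj (z : F) w : z ^+ size w = 1 -> z ^+ rmaj (head 0%N w) w = z ^+
  maj w.
Proof.
move=> zn; have [c ->] := rmaj_maj w.
by rewrite exprD mulnC exprM zn expr1n mulr1.
Qed.

Lemma expr_maj_rot1 (z : F) w : z ^+ size w = 1 ->
  z ^+ maj (rot 1 w) * z ^+ cdes w = z ^+ maj w.
Proof.
move=> zn; rewrite -expr_rmaj ?size_rot // -expr_rmaj // -exprD.
by have [c ->] := rmaj_rot1 w; rewrite exprD mulnC exprM zn expr1n mulr1.
Qed.

Lemma cdes_word_cdt alpha delta n w : size delta = size alpha ->
  w \in all_words n (size alpha) -> word_cdt alpha delta w -> cdes w = sumn
    delta.
Proof.
rewrite mem_all_words => size_delta /andP[_ le_w] /and3P[w_pos _ /eqP cdt_w].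
by rewrite -(subword_le_id le_w); apply: cdes_subword_le.
Qed.

Lemma sum_maj_word_cdt (z : F) alpha delta g d : d.-primitive_root z ->
    (0 < sumn alpha)%N -> (g * d)%N = sumn alpha ->
  \sum_(w <- all_words (sumn alpha) (size alpha) | word_cdt alpha delta w) z ^+
    maj w
    = (count (fun w => word_cdt alpha delta w && (rot g w == w))
         (all_words (sumn alpha) (size alpha)))%:R.
Proof.
move=> prim_z n_gt0 gd; set n := sumn alpha in n_gt0 gd *; set m := size alpha.
have d_gt0 := prim_order_gt0 prim_z.
have zn : z ^+ n = 1 by rewrite -gd mulnC exprM (prim_expr_order prim_z) expr1n.
set P := word_cdt alpha delta.
have size_aw w : w \in all_words n m -> size w = n.
  by rewrite mem_all_words => /andP[/eqP].
have [size_delta|size_delta] := eqVneq (size delta) m; last first.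
  have P0 w : P w = false.
    apply: contraNF size_delta => /and3P[_ _ /eqP/(congr1 size)].
    by rewrite !size_map size_iota => <-.
  rewrite big_pred0 // (eq_count (a2 := pred0)) ?count_pred0 // => w.
  by rewrite /= -/P P0.
have -> : (count (fun w => P w && (rot g w == w)) (all_words n m))%:R
    = \sum_(w <- all_words n m | P w) (rot g w == w)%:R :> F.
  rewrite -sum1_count big_mkcondr /= natr_sum; apply: eq_bigr => w _;
    by case: eqP.
have [dK|ndK] := boolP (d %| sumn delta)%N; last first.
  (* A word fixed by [rot g] is a [d]-th power, so [d] would divide its number of cyclic descents;
     hence no word is fixed. *)
  rewrite [RHS]big_seq_cond [RHS]big1 => [|w /andP[ww Pw]]; last first.
    case: eqP => // rot_w; case/negP: ndK.
    rewrite -(cdes_word_cdt size_delta ww Pw) (@rot_fixed_wpow _ g d w)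
      ?size_aw //.
    by rewrite cdes_wpow dvdn_mulr.
  set S := \sum_(w <- _ | _) _.
  (* Rotation permutes the words and divides each [z ^+ maj w] by [z ^+ sumn delta], which is not 1;
     this forces [S = 0]. *)
  have : S * (z ^+ sumn delta - 1) = 0.
    rewrite mulrBr mulr1 {1}/S -(perm_big _ (perm_rot_all_words 1 n m)) [X in X
      * _]big_map.
    rewrite mulr_suml; apply/eqP; rewrite subr_eq0; apply/eqP.
    rewrite /S big_seq_cond [RHS]big_seq_cond; apply: eq_big => w.
      by rewrite /P word_cdt_rot1.
    rewrite /P word_cdt_rot1 => /andP[ww Pw].
    by rewrite -(cdes_word_cdt size_delta ww Pw) expr_maj_rot1 ?size_aw.
  move/eqP; rewrite mulf_eq0 subr_eq0 -(prim_order_dvd prim_z) (negbTE ndK)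
    orbF.
  by move/eqP.
have [/hasP[w0 w0w Pw0]|noP] := boolP (has P (all_words n m)); last first.
  by rewrite big_seq_cond [RHS]big_seq_cond !big1 // => w /andP[ww Pw];
    case/hasP: noP; exists w.
(* All words of the same content contain their least letter equally often. *)
pose c := count (fun x => all (leq x) w0) w0.
have c_gt0 : (0 < c)%N.
  by rewrite -has_count exists_min // -size_eq0 size_aw // -lt0n.
have P_count : {in all_words n m, forall w, P w -> count (fun x => all (leq x)
  w) w = c}.
  move=> w ww Pw; have [le_w le_w0] : all (fun x => x <= m)%N w /\ all (fun x
    => x <= m)%N w0.
    by move: ww w0w; rewrite !mem_all_words => /andP[_ ->] /andP[_ ->].
  case/and3P: Pw Pw0 => w_pos /eqP cont_w _ /and3P[w0_pos /eqP cont_w0 _].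
  have w_w0 : perm_eq w w0 by apply: (@perm_eq_content m); rewrite ?cont_w.
  rewrite /c -(seq.permP w_w0); apply: eq_count => x.
  by apply: eq_all_r; apply: perm_mem.
apply: (@mulfI _ c%:R); first by rewrite pnatr_eq0 -lt0n.
rewrite (sum_min_head (P := P) (n := n) _ _ P_count) //; first last.
- move=> w ww Pw; rewrite -[RHS]expr_maj_rot1 ?size_aw // (cdes_word_cdt
  size_delta ww Pw).
  by rewrite -(divnK dK) mulnC exprM (prim_expr_order prim_z) expr1n mulr1.
- by move=> w; apply: word_cdt_rot1.
rewrite (sum_min_head (P := P) (n := n) _ _ P_count) //; first last.
- move=> w _ _; congr (nat_of_bool _)%:R.
  by rewrite rot_rot (inj_eq (@rot_inj _ _)).
- by move=> w; apply: word_cdt_rot1.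
congr (_ * _); have E := @word_cdt_min_head alpha delta n erefl.
rewrite -big_filter (perm_big _ E) -[RHS]big_filter [RHS](perm_big _ E) /=.
transitivity (min_genfun z alpha delta).
  rewrite /min_genfun big_seq [RHS]big_seq; apply: eq_bigr => w.
  by rewrite mem_min_words => /size_min_word size_w; rewrite expr_rmaj ?size_w.
rewrite (min_genfun_prim_root prim_z) //; last by rewrite -/n -gd dvdn_mull.
rewrite min_genfun1 -natr_sum -big_mkcond sum1_count (count_min_words_rot _
  d_gt0 gd).
by case: ifP.
Qed.

End RotationSums.

(** Deleting letters cannot increase [cdes], so no entry is negative. *)
Lemma CDT_abs m w : CDT m w = map Posz (map absz (CDT m w)).
Proof.
rewrite -map_comp -[LHS]map_id; apply/eq_in_map => x /mapP[i _ ->] /=.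
have : cdes (subword_le i.-1 w) <= cdes (subword_le i w).
  by rewrite -(@subword_le_sub i.-1 i) ?leq_pred // cdes_filter.
by lia.
Qed.

Definition word_content (alpha : seq nat) (w : seq nat) : bool :=
  is_word w && (content (size alpha) w == alpha).

Lemma word_content_cdt alpha delta w :
  word_content alpha w && (map absz (CDT (size alpha) w) == delta)
    = word_cdt alpha delta w.
Proof.
rewrite /word_content /word_cdt -andbA; do 2 congr (_ && _).
by rewrite [in RHS]CDT_abs (inj_eq (inj_map _)) // => x y [].
Qed.

(** Both sides are additive over the cyclic descent types that occur, and [sum_maj_word_cdt] treats
    each type. *)
Lemma sum_maj_word_content (F : numFieldType) (z : F) alpha g d :
    (d.-primitive_root z)%R -> 0 < sumn alpha -> g * d = sumn alpha ->
  (\sum_(w <- all_words (sumn alpha) (size alpha) | word_content alpha w) z ^+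
    maj w
    = (count (fun w => word_content alpha w && (rot g w == w))
         (all_words (sumn alpha) (size alpha)))%:R)%R.
Proof.
move=> prim_z n_gt0 gd; set aw := all_words _ _.
pose cdt w := map absz (CDT (size alpha) w).
pose cdts := undup (map cdt aw).
have split_cdt (f : seq nat -> F) :
    (\sum_(w <- aw | word_content alpha w) f w
      = \sum_(delta <- cdts) \sum_(w <- aw | word_cdt alpha delta w) f w)%R.
  under [RHS]eq_bigr => delta _ do rewrite big_mkcond.
  rewrite exchange_big /= big_mkcond big_seq [RHS]big_seq;
    apply: eq_bigr => w ww.
  under [RHS]eq_bigr => delta _ do rewrite -word_content_cdt.
  case: (word_content alpha w) => /=; last by rewrite big1.
  rewrite (bigD1_seq (cdt w)) ?undup_uniq ?mem_undup ?map_f //= eqxx big1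
    ?addr0 //.
  by move=> delta; rewrite eq_sym => /negbTE->.
rewrite split_cdt -sum1_count natr_sum big_mkcondr /=.
rewrite split_cdt; apply: eq_bigr => delta _.
rewrite (sum_maj_word_cdt _ prim_z n_gt0 gd) -sum1_count natr_sum big_mkcondr
  /=.
by [].
Qed.

Lemma iter_rot1 (T : Type) k (s : seq T) : k <= size s -> iter k (rot 1) s =
  rot k s.
Proof.
elim: k => [|k IHk] lt_ks; first by rewrite rot0.
by rewrite iterS IHk ?(ltnW lt_ks) // [RHS]rotS.
Qed.

Lemma iter_fixed (T : Type) (f : T -> T) k c x : iter k f x = x -> iter (c * k)
  f x = x.
Proof. by move=> fx; elim: c => // c IHc; rewrite mulSn iterD IHc. Qed.

(** Rotation by the full length is trivial, so by Bezout invariance under [j] steps gives invariance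
    under the gcd; the converse holds since the gcd divides [j]. *)
Lemma rotr_fixed_gcdn (T : eqType) (s : seq T) j : j < size s ->
  (rotr j s == s) = (rot (gcdn j (size s)) s == s).
Proof.
move=> lt_js; set n := size s in lt_js *.
have n_gt0 : 0 < n by apply: leq_ltn_trans lt_js.
have g_le : gcdn j n <= n by rewrite dvdn_leq // dvdn_gcdr.
have rot_n : iter n (rot 1) s = s by rewrite iter_rot1 // rot_size.
have -> : (rotr j s == s) = (iter j (rot 1) s == s).
  by rewrite iter_rot1 ?(ltnW lt_js) // -(inj_eq (@rot_inj j _)) rotrK eq_sym.
rewrite -iter_rot1 //; apply/eqP/eqP => [js|gs]; last first.
  by rewrite -(divnK (dvdn_gcdl j n)); apply: iter_fixed.
have [j0|j_gt0] := posnP j; first by rewrite j0 gcd0n.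
case: (egcdnP n j_gt0) => km kn e _.
have := iter_fixed km js; rewrite e addnC iterD (iter_fixed kn) //.
Qed.

(** * From sums over words to cyclic sieving *)

Section CSPWords.
Local Open Scope ring_scope.

Variable C : numClosedFieldType.

Lemma poly_nat_eval_genfun (T : finType) (stat : T -> nat) (W : {set T}) (z :
  C) :
  poly_nat_eval (genfun stat W) z = \sum_(w in W) z ^+ stat w.
Proof.
rewrite /poly_nat_eval /genfun.
rewrite rmorph_sum horner_sum; apply: eq_bigr => w _.
by rewrite /= map_polyXn hornerXn.
Qed.

Variables (n : nat) (n_gt0 : (0 < n)%N).

Lemma cyc_gen_cycle : [set: cyc n] = <[cyc_gen n]>%g.
Proof. exact: Zp_cycle. Qed.

Lemma order_cyc_gen : #[cyc_gen n]%g = n.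
Proof. by rewrite /order -cyc_gen_cycle cardsT card_ord prednK. Qed.

(** Powers of [omega] depend only on the exponent modulo [n], so [phi] is multiplicative; this also
    settles negative [k]. *)
Lemma expr_zexpg_cyc_gen (omega : C) (k : int) : n.-primitive_root omega ->
  omega ^+ (zexpg (cyc_gen n) k : 'I_n.-1.+1) = omega ^ k.
Proof.
move=> prim; pose phi (x : cyc n) := omega ^+ (x : 'I_n.-1.+1).
have prim' : n.-1.+1.-primitive_root omega by rewrite prednK.
have phiM x y : phi (x * y)%g = phi x * phi y.
  by rewrite /phi -exprD; apply: (prim_expr_mod prim').
have phi1 : phi 1%g = 1 by [].
have phiX i : phi (cyc_gen n ^+ i)%g = omega ^+ i.
  elim: i => [|i IHi]; first by rewrite expg0 phi1.
  by rewrite expgS phiM IHi exprS; congr (_ * _);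
    apply: (prim_expr_mod prim' 1).
case: k => i; first exact: phiX.
have Xi0 : omega ^+ i.+1 != 0.
  rewrite expf_neq0 //; apply: contraTneq (oner_neq0 C) => omega0.
  by rewrite -(prim_expr_order prim) omega0 expr0n (gtn_eqF n_gt0) eqxx.
rewrite /exprz; apply: (mulfI Xi0).
by rewrite divff // -{1}phiX -phiM mulgV.
Qed.

(** With [g = gcdn j n], the power [omega ^+ j] is a primitive root of order [n %/ g], and rotation
    by [j] fixes the same words as rotation by [g]. *)
Lemma CSP_words (m : nat) (P : pred (seq nat)) (W : {set wordType n m}) :
    (forall w, (w \in W) = P (word_of w)) -> (forall w, P (rot 1 w) = P w) ->
    (forall (z : C) g d, d.-primitive_root z -> (g * d)%N = n ->
      \sum_(w <- all_words n m | P w) z ^+ maj w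
        = (count (fun w => P w && (rot g w == w)) (all_words n m))%:R) ->
  CSP C n (cyc_gen n) (rot_act n 'I_m.+1) W (genfun (@word_maj n m) W).
Proof.
move=> WP P_rot P_sum.
have lt_cyc (x : cyc n) : ((x : 'I_n.-1.+1) < n)%N.
  by rewrite -[X in (_ < X)%N](prednK n_gt0).
have actE (w : wordType n m) (x : cyc n) :
    word_of (rot_act n 'I_m.+1 w x) = rotr (x : 'I_n.-1.+1) (word_of w).
  rewrite /word_of /= /rot_fun val_rotate_iter rotr1_iter ?map_rotr //.
  by rewrite size_tuple ltnW.
split; [exact: cyc_gen_cycle | exact: order_cyc_gen | |].
  apply/actsP => x _ w; rewrite !WP actE.
  by rewrite -[in RHS](rotrK (x : 'I_n.-1.+1) (word_of w)) (rot_invariant _ _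
    P_rot).
move=> omega prim k; rewrite poly_nat_eval_genfun -(expr_zexpg_cyc_gen k prim).
set x := zexpg _ _; set j := nat_of_ord _.
have prim_j := exp_prim_root prim j.
have gd : (gcdn j n * (n %/ gcdn j n))%N = n by rewrite mulnC divnK ?dvdn_gcdr.
transitivity (\sum_(w <- all_words n m | P w) (omega ^+ j) ^+ maj w);
  last first.
  by rewrite big_map big_enum_cond; apply: eq_bigl => w; rewrite WP.
rewrite (P_sum _ _ _ prim_j gd) -sum1_count big_map big_enum_cond -sum1_card.
congr (_%:R); apply: eq_bigl => w; rewrite !inE WP /=.
congr (_ && _); rewrite sub1set inE -(inj_eq (@word_of_inj n m)) actE.
have size_w : size (word_of w) = n by rewrite size_map size_tuple.
by rewrite rotr_fixed_gcdn size_w.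
Qed.

End CSPWords.

Theorem theorem1p5 (C : numClosedFieldType) (n : nat) (hn : 0 < n)
    (alpha : seq nat) (halpha : sumn alpha = n) (delta : seq nat) :
  CSP C n (cyc_gen n) (rot_act n 'I_(size alpha).+1)
    (words_cont_cdt n alpha delta)
    (genfun (@word_maj n (size alpha)) (words_cont_cdt n alpha delta)) /\
  CSP_refinement C n (cyc_gen n) (rot_act n 'I_(size alpha).+1)
    (@word_maj n (size alpha))
    (words_cont n alpha) (words_cont_cdt n alpha delta).
Proof.
have csp_cdt : CSP C n (cyc_gen n) (rot_act n 'I_(size alpha).+1)
    (words_cont_cdt n alpha delta)
    (genfun (@word_maj n (size alpha)) (words_cont_cdt n alpha delta)).
  apply: (CSP_words hn (P := word_cdt alpha delta)) => [w|w|z g d prim_z gd].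
  - by rewrite !inE /word_cdt andbA.
  - exact: word_cdt_rot1.
  - by subst n; apply: (sum_maj_word_cdt _ prim_z).

split=> //; split=> //.
  apply: (CSP_words hn (P := word_content alpha)) => [w|w|z g d prim_z gd].
  - by rewrite !inE.
  - by rewrite /word_content is_word_rot1 content_rot1.
  - by subst n; apply: (sum_maj_word_content prim_z).
by apply/subsetP => w; rewrite inE => /andP[].
Qed.
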